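(* Let $\varkappa$ be a positive integer. If $\boldsymbol A=(A_1,\dots,A_\varkappa)$ is a $\varkappa$-tuple of bounded linear operators on a complex Hilbert space $\mathcal H$ and $Y\subset\mathbb T^\varkappa$ is a determining set for $\mathcal P_+(\mathbb T^\varkappa)$, then the following conditions are equivalent: (i) $\boldsymbol A$ has a unitary power dilation and the operators $A_1,\dots,A_\varkappa$ commute; (ii) for every finite system $\{a_\alpha^{i,j}\colon i,j=1,\dots,m,\ \alpha\in\mathbb Z_+^\varkappa\cup\mathbb Z_-^\varkappa\}\subset\mathbb C$ ($m\ge1$ arbitrary), if $$\sum_{i,j=1}^m\sum_{\alpha\in\mathbb Z_+^\varkappa\cup\mathbb Z_-^\varkappa}a_\alpha^{i,j}\lambda^\alpha z_i\bar z_j\ge0,\quad\lambda\in\mathbb T^\varkappa,\ z_1,\dots,z_m\in\mathbb C,$$ then $$\sum_{i,j=1}^m\sum_{\alpha\in\mathbb Z_+^\varkappa\cup\mathbb Z_-^\varkappa}a_\alpha^{i,j}\langle\boldsymbol A^{[\alpha]}f_i,f_j\rangle\ge0,\quad f_1,\dots,f_m\in\mathcal H;$$ (iii) for every finite system $\{a_\alpha^{i,j}\colon i,j=1,\dots,m,\ \alpha\in\mathbb Z_+^\varkappa\cup\mathbb Z_-^\varkappa\}\subset\mathbb C$ ($m\ge1$ arbitrary), if there is a finite matrix $[q_{i,l}]_{i=1,\dots,m;\ l=1,\dots,k}$ with entries in $\mathcal P_+(\mathbb T^\varkappa)$ such that $$\sum_{\alpha\in\mathbb Z_+^\varkappa\cup\mathbb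 Z_-^\varkappa}a_\alpha^{i,j}\lambda^\alpha=\sum_{l=1}^kq_{i,l}(\lambda)\overline{q_{j,l}(\lambda)},\quad\lambda\in Y,\ i,j=1,\dots,m,$$ then $$\sum_{i,j=1}^m\sum_{\alpha\in\mathbb Z_+^\varkappa\cup\mathbb Z_-^\varkappa}a_\alpha^{i,j}\langle\boldsymbol A^{[\alpha]}f_i,f_j\rangle\ge0,\quad f_1,\dots,f_m\in\mathcal H.$$
   Context: $\mathbb T=\{z\in\mathbb C\colon|z|=1\}$, $\mathbb Z_+=\{0,1,2,\dots\}$, $\mathbb Z_-=-\mathbb Z_+$. For $z\in\mathbb T^\varkappa$ and $\alpha\in\mathbb Z^\varkappa$, $z^\alpha=z_1^{\alpha_1}\cdots z_\varkappa^{\alpha_\varkappa}$. A system of complex numbers is finite if only finitely many members are nonzero. $\mathcal P_+(\mathbb T^\varkappa)$ (analytic trigonometric polynomials) is the set of all functions $p\colon\mathbb T^\varkappa\to\mathbb C$ of the form $p(z)=\sum_{\alpha\in\mathbb Z_+^\varkappa}a_\alpha z^\alpha$ with $\{a_\alpha\}$ a finite system of complex numbers. A nonempty $Y\subset\mathbb T^\varkappa$ is determining for $\mathcal P_+(\mathbb T^\varkappa)$ if each $p\in\mathcal P_+(\mathbb T^\varkappa)$ vanishing on $Y$ vanishes on $\mathbb T^\varkappa$. For $\alpha\in\mathbb Z_+^\varkappa\cup\mathbb Z_-^\varkappa$, $\boldsymbol A^{[\alpha]}=A_1^{\alpha_1}\cdots A_\varkappa^{\alpha_\varkappa}$ if $\alpha\in\mathbb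 Z_+^\varkappa$, and $\boldsymbol A^{[\alpha]}=A_1^{*|\alpha_1|}\cdots A_\varkappa^{*|\alpha_\varkappa|}$ if $\alpha\in\mathbb Z_-^\varkappa$; for $\alpha\in\mathbb Z_+^\varkappa$ one writes $\boldsymbol A^\alpha=\boldsymbol A^{[\alpha]}$. The tuple $\boldsymbol A$ has a unitary power dilation if there exist a complex Hilbert space $\mathcal K\supset\mathcal H$ (isometric embedding) and a $\varkappa$-tuple $\boldsymbol U=(U_1,\dots,U_\varkappa)$ of commuting unitary operators on $\mathcal K$ such that $\boldsymbol A^\alpha=P\boldsymbol U^\alpha|_{\mathcal H}$ for all $\alpha\in\mathbb Z_+^\varkappa$, where $P$ is the orthogonal projection of $\mathcal K$ onto $\mathcal H$. *)

(* Defs.v *)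
From HB Require Import structures.
From mathcomp Require Import all_boot all_order all_algebra.
From mathcomp Require Import sesquilinear complex.
From mathcomp Require Import all_classical all_reals all_analysis.

Set Implicit Arguments.
Unset Strict Implicit.
Unset Printing Implicit Defensive.

Import Order.TTheory GRing.Theory Num.Theory.
Import numFieldNormedType.Exports.

Local Open Scope classical_set_scope.
Local Open Scope ring_scope.

(* The complex field is R[i] for an arbitrary R : realType. Its order is the
   partial one: 0 <= z means that z is real and nonnegative; the norm of a
   normed R[i]-module takes values in R[i]. *)

(* {dot H for Num.conj}: positive definite, linear in the first argument and
   conjugate-linear in the second. *)
HB.mixin Record CompleteNormedModule_isHilbert (R : realType) H
    of CompleteNormedModule R[i] H := {
  inner : {dot H for (@Num.conj R[i])} ;
  innerE : forall x : H, inner x x = `|x| ^+ 2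
}.

#[short(type="hilbertType")]
HB.structure Definition Hilbert (R : realType) :=
  {H of CompleteNormedModule_isHilbert R H & CompleteNormedModule R[i] H}.

Arguments inner {R s}.

Section Operators.
Context {R : realType} {H : hilbertType R}.

Definition bounded_op (A : {linear H -> H}) : Prop :=
  exists c : R[i], forall x, `|A x| <= c * `|x|.

(* For bounded A such a w exists and is unique (Riesz); the default value 0 of
   xget is irrelevant then. *)
Definition adj (A : {linear H -> H}) (y : H) : H :=
  xget 0 [set w | forall x, inner (A x) y = inner x w].

Definition unitary_op (U : {linear H -> H}) : Prop :=
  [/\ bounded_op U, adj U \o U =1 id & U \o adj U =1 id].

Definition commuting (I : Type) (A : I -> {linear H -> H}) : Prop :=
  forall i j, A i \o A j =1 A j \o A i.

Definition orthogonal_projection (M : set H) (P : H -> H) : Prop :=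
  forall y, M (P y) /\ forall w, M w -> inner (y - P y) w = 0.

End Operators.

Section MultiIndices.
Variable k : nat.

Definition Zplus : set {ffun 'I_k -> int} := [set al | forall i, 0 <= al i].
Definition Zminus : set {ffun 'I_k -> int} := [set al | forall i, al i <= 0].

Definition finite_system (R : realType) (a : {ffun 'I_k -> int} -> R[i]) : Prop :=
  finite_set [set al | a al != 0].

End MultiIndices.

Arguments Zplus {k}.
Arguments Zminus {k}.

Section Torus.
Variables (R : realType) (k : nat).

Definition torus : set ('I_k -> R[i]) := [set z | forall i, `|z i| = 1].

Definition monomial (z : 'I_k -> R[i]) (al : {ffun 'I_k -> int}) : R[i] :=
  \prod_(i < k) z i ^ al i.

(* Functions on the torus are represented by total functions of which only the
   restriction to the torus matters. *)
Definition analytic_trig_poly (p : ('I_k -> R[i]) -> R[i]) : Prop :=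
  exists2 a : {ffun 'I_k -> int} -> R[i], finite_system a &
    forall z, torus z -> p z = \sum_(al \in Zplus) (a al * monomial z al).

Definition determining (Y : set ('I_k -> R[i])) : Prop :=
  [/\ Y !=set0, Y `<=` torus &
    forall p, analytic_trig_poly p ->
      (forall z, Y z -> p z = 0) -> forall z, torus z -> p z = 0].

End Torus.

Section MultiPowers.
Context {R : realType} {k : nat}.

(* B_1^|al_1| \o ... \o B_k^|al_k|, in this order. *)
Definition abs_power (H : Type) (B : 'I_k -> H -> H) (al : {ffun 'I_k -> int}) :
    H -> H :=
  \big[(fun f g => f \o g)/id]_(i < k) iter `|al i|%N (B i).

(* Meaningful on Zplus `|` Zminus only; at al = 0 both branches are the
   identity. *)
Definition bracket_power (H : hilbertType R) (A : 'I_k -> {linear H -> H})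
    (al : {ffun 'I_k -> int}) : H -> H :=
  if `[< Zplus al >] then abs_power (fun i => A i) al
  else abs_power (fun i => adj (A i)) al.

(* J embeds H isometrically into K, P is the orthogonal projection of K onto
   the copy of H. *)
Definition has_unitary_power_dilation (H : hilbertType R)
    (A : 'I_k -> {linear H -> H}) : Prop :=
  exists (K : hilbertType R) (J : {linear H -> K})
         (U : 'I_k -> {linear K -> K}) (P : K -> K),
    [/\ forall x, `|J x| = `|x|,
        forall i, unitary_op (U i),
        commuting U,
        orthogonal_projection (range J) P &
        forall al, Zplus al -> forall x,
          J (bracket_power A al x) = P (bracket_power U al (J x))].

End MultiPowers.

(* Main.v *)
(**
  (i) => (ii): for commuting unitaries U and a positive semidefinite matrix P of
  trigonometric polynomials, positivity of \sum_ij <P_ij(U) f_i, f_j> needs no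
  spectral theorem: testing P at roots of unity against the vectors
  \sum_b conj(lam^b) U^b f_i, with b in [0, N)^k, gives the inequality with every
  frequency al weighted by the Fejer factor \prod_l (1 - |al_l| / N), and one lets
  N tend to infinity.  The dilation and the commutation of the A_l turn
  <A^[al] f, g> into <U^al f, g>.

  (ii) => (iii): a trigonometric polynomial vanishing on Y, multiplied by a
  monomial, is analytic, so the factorization on Y holds on the whole torus.

  (iii) => (i): the systems (c lam^al, 1) give <A^[al] f, g> = conj <A^[-al] g, f>,
  hence the adjoint relations and commutation.  Expanding vectors in a finite
  orthonormal family, (iii) says that the functional sending
  Re (lam^al <f, x> <x, g>) to Re <A^[al] f, g>, for al in Zplus or Zminus, is
  nonnegative on sums of squares |h(lam, x)|^2 of H-valued trigonometric
  polynomials h.  These real functions of (lam, x) are bounded by those of frequency 0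
  modulo sums of squares, so the theorem of M. Riesz extends the functional
  to all frequencies, keeping positivity.  Its extension l defines the semi-inner product
  l(h h'^* ) on H-valued trigonometric polynomials; in the completion,
  multiplication by the coordinates lam_i is the unitary dilation.
*)

Require Import Defs.
From HB Require Import structures.
From mathcomp Require Import all_boot all_order all_algebra.
From mathcomp Require Import sesquilinear complex.
From mathcomp Require Import all_classical all_reals all_analysis.
From mathcomp Require Import cyclic separable cyclotomic ring lra zify.

Set Implicit Arguments.
Unset Strict Implicit.
Unset Printing Implicit Defensive.

Import Order.TTheory GRing.Theory Num.Theory.
Import numFieldNormedType.Exports.

Local Open Scope classical_set_scope.
Local Open Scope ring_scope.

(** * Inner products and finite frames *)

Section InnerProduct.
Context {R : realType} {H : hilbertType R}.
Implicit Types (x y z : H) (a : R[i]).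

Lemma innerC x y : inner x y = (inner y x)^*.
Proof. by rewrite hermC expr0 mul1r. Qed.

Lemma innerDl x y z : inner (x + y) z = inner x z + inner y z.
Proof. exact: linearDl. Qed.

Lemma innerDr x y z : inner z (x + y) = inner z x + inner z y.
Proof. exact: linearDr. Qed.

Lemma innerBl x y z : inner (x - y) z = inner x z - inner y z.
Proof. exact: linearBl. Qed.

Lemma innerBr x y z : inner z (x - y) = inner z x - inner z y.
Proof. exact: linearBr. Qed.

Lemma innerZl a x y : inner (a *: x) y = a * inner x y.
Proof. exact: linearZl_LR. Qed.

Lemma innerZr a x y : inner x (a *: y) = a^* * inner x y.
Proof. exact: linearZr_LR. Qed.

Lemma inner0l x : inner 0 x = 0.
Proof. exact: linear0l. Qed.

Lemma inner0r x : inner x 0 = 0.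
Proof. exact: linear0r. Qed.

Lemma inner_suml I (r : seq I) (P : pred I) (F : I -> H) z :
  inner (\sum_(i <- r | P i) F i) z = \sum_(i <- r | P i) inner (F i) z.
Proof. by apply: (big_morph (fun x => inner x z)) => [x y|]; rewrite (inner0l, innerDl). Qed.

Lemma inner_sumr I (r : seq I) (P : pred I) (F : I -> H) z :
  inner z (\sum_(i <- r | P i) F i) = \sum_(i <- r | P i) inner z (F i).
Proof. by apply: (big_morph (inner z)) => [x y|]; rewrite (inner0r, innerDr). Qed.

Lemma inner_eq x y : (forall z, inner x z = inner y z) -> x = y.
Proof.
move=> xy; apply/eqP; rewrite -subr_eq0 -(dnorm_eq0 inner).
by rewrite innerBl xy subrr.
Qed.

(** For an orthonormal [e], possibly with zero vectors added, this is the orthogonal projection of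
    [f] onto the span of [e]. *)
Definition frame_expansion (e : seq H) (f : H) : H :=
  \sum_(u <- e) inner f u *: u.

Lemma inner_frame_expansion e x y :
  inner (frame_expansion e x) y = inner x (frame_expansion e y).
Proof.
rewrite inner_suml inner_sumr; apply: eq_bigr => u _.
by rewrite innerZl innerZr -innerC mulrC.
Qed.

(* Gram-Schmidt; the zero vector is allowed in the family [e], so that no case
   distinction is needed when a vector is already spanned. *)
Lemma finite_frame (s : seq H) :
  exists e : seq H, {in s, forall f, frame_expansion e f = f}.
Proof.
suff [e [_ es]] : exists e : seq H, {in e, forall u, frame_expansion e u = u} /\
    {in s, forall f, frame_expansion e f = f} by exists e.
elim: s => [|f s [e [ee es]]]; first by exists [::].
pose r := f - frame_expansion e f; pose u := `|r|^-1 *: r.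
(* The expansion is self-adjoint, so the residue [r] is orthogonal to every vector that the
   expansion fixes, in particular to the members of [e]. *)
have er w : frame_expansion e w = w -> inner r w = 0.
  by move=> ew; rewrite innerBl inner_frame_expansion ew subrr.
have eu w : frame_expansion e w = w -> inner u w = 0.
  by move=> ew; rewrite innerZl er ?mulr0.
have Er w : frame_expansion (u :: e) w = inner w u *: u + frame_expansion e w.
  by rewrite /frame_expansion big_cons.
have nr : inner r r = `|r| ^+ 2 by rewrite innerE.
have ew0 w : frame_expansion e w = w -> frame_expansion (u :: e) w = w.
  by move=> ew; rewrite Er innerC eu // conjC0 scale0r add0r.
have e0 : frame_expansion e u = 0.
  apply: big1_seq => w /andP[_ we].
  by rewrite eu ?scale0r // ee.
have ru : inner r u *: u = r.
  rewrite innerZr nr scalerA geC0_conj ?invr_ge0 //.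
  have [->|r0] := eqVneq r 0; first by rewrite scaler0.
  have nr0 : `|r| != 0 by rewrite normr_eq0.
  by rewrite (_ : _ * _ = 1) ?scale1r //; field.
have uu : frame_expansion (u :: e) u = u.
  by rewrite Er e0 addr0 {1}/u innerZl -scalerA ru.
have ff : frame_expansion (u :: e) f = f.
  have fE : f = r + frame_expansion e f by rewrite subrK.
  rewrite Er [in inner f u]fE innerDl inner_frame_expansion e0 inner0r addr0.
  by rewrite ru subrK.
exists (u :: e); split=> w; rewrite inE => /orP[/eqP-> //|wl].
- exact/ew0/ee.
- exact/ew0/es.
Qed.

End InnerProduct.

(** * Extension of positive functionals *)

Section RieszExtension.
Context {R : realType} {V : lmodType R}.
Variables (C W : set V) (g : set (V * R)).
Hypothesis CD : forall x y, C x -> C y -> C (x + y).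
Hypothesis CZ : forall (a : R) x, 0 <= a -> C x -> C (a *: x).
Hypothesis WN : forall x, W x -> W (- x).

(** Partial functionals are handled through their graphs, so that a chain of them is joined by a
    plain union. Single-valuedness is not built in; it will follow from positivity. *)
Definition linear_graph (h : set (V * R)) :=
  forall (a : R) p q, h p -> h q -> h (a *: p.1 + q.1, a * p.2 + q.2).

Definition positive_graph (h : set (V * R)) := forall p, h p -> C p.1 -> 0 <= p.2.

Hypothesis g0 : g (0, 0).
Hypothesis glin : linear_graph g.
Hypothesis gpos : positive_graph g.
Hypothesis gcof : forall v, W v -> exists2 p, g p & C (p.1 - v).

Let good h := [/\ g `<=` h, linear_graph h & positive_graph h].

Let extend (h : set (V * R)) v0 t : set (V * R) :=
  [set p | exists2 q, h q & exists a : R, p = (q.1 + a *: v0, q.2 + a * t)].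

Let goodB h p q : good h -> h p -> h q -> h (p.1 - q.1, p.2 - q.2).
Proof.
move=> [_ hlin _] hp hq; have := hlin (-1) _ _ hq hp.
by rewrite scaleN1r mulN1r addrC [- _ + _]addrC.
Qed.

(** Positivity at [q.1 + a *: v0] bounds the new value [t] from below for a > 0 and from above for a
    < 0. Every lower bound is at most every upper bound because [C] is closed under addition, and
    cofinality provides bounds of both sorts, so the supremum [sup L] of the lower ones is a valid
    choice. *)
Let good_extend h v0 : good h -> W v0 ->
  exists t, good (extend h v0 t).
Proof.
move=> hg Wv0; have [gh hlin hpos] := hg.
have h0 : h (0, 0) by exact: gh.
have hZ a q : h q -> h (a *: q.1, a * q.2).
  by move=> hq; have := hlin a _ _ hq h0; rewrite !addr0.
pose L := [set r | exists2 q, h q & C (v0 - q.1) /\ r = q.2].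
have Lub q : h q -> C (q.1 - v0) -> ubound L q.2.
  move=> hq Cq _ [q' hq' [Cq' ->]]; rewrite -subr_ge0.
  apply: (hpos _ (goodB hg hq hq')) => /=.
  by rewrite -(subrK v0 q.1) -addrA; exact: CD.
have Ln : L !=set0.
  have [q gq Cq] := gcof (WN Wv0).
  exists (- q.2), (-1 *: q.1, -1 * q.2); first exact/hZ/gh.
  by split; rewrite /= ?mulN1r // scaleN1r opprK addrC -[v0]opprK.
have Lb : has_ubound L.
  by have [q gq Cq] := gcof Wv0; exists q.2; apply: Lub => //; exact: gh.
exists (sup L); split.
- move=> [w r] /gh hwr; exists (w, r) => //; exists 0.
  by rewrite scale0r mul0r !addr0.
- move=> a _ _ [q hq [b ->]] [q' hq' [b' ->]].
  exists (a *: q.1 + q'.1, a * q.2 + q'.2); first exact: hlin.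
  exists (a * b + b') => /=; congr pair; last by ring.
  by rewrite scalerDr scalerA scalerDl addrACA.
- move=> _ [q hq [a ->]] /= Ca.
  (* Dividing by |a| reduces the first two cases to one upper and one lower bound on [sup L]. *)
  have [a0|a0|a0] := ltgtP a 0.
  + have Na : 0 <= - a^-1 by rewrite oppr_ge0 invr_le0 ltW.
    have := CZ Na Ca; rewrite scalerDr scalerA mulNr mulVf ?lt_eqF // scaleN1r.
    move=> /(Lub _ (hZ (- a^-1) _ hq)) /= H1.
    have := ge_sup Ln H1; rewrite mulNr -mulrN mulrC ler_ndivlMr //.
    by rewrite -subr_ge0 opprK addrC [a * _]mulrC.
  + have Pa : 0 <= a^-1 by rewrite invr_ge0 ltW.
    have := CZ Pa Ca; rewrite scalerDr scalerA mulVf ?gt_eqF // scale1r.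
    move=> Cq; have : L (- a^-1 * q.2).
      exists (- a^-1 *: q.1, - a^-1 * q.2); first exact: hZ.
      by split=> //=; rewrite scaleNr opprK addrC.
    move=> /(sup_upper_bound (conj Ln Lb)); rewrite mulNr -mulrN mulrC.
    by rewrite ler_pdivrMr // -subr_ge0 opprK addrC [a * _]mulrC.
  + by move: Ca; rewrite a0 scale0r mul0r !addr0; exact: hpos.
Qed.

Let exists_total : exists2 h, good h & forall v, W v -> exists r, h (v, r).
Proof.
have [|h [hP hmax]] := @Zorn_bigcup (V * R)%type [set h | h = set0 \/ good h].
  move=> F FP Ftot.
  have [[X FX X0]|F0] := pselect (exists2 X, F X & X != set0); last first.
    left; rewrite -subset0 => p [X FX Xp]; apply: F0; exists X => //.
    by apply/set0P; exists p.
  have Fgood Y : F Y -> Y !=set0 -> good Y.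
    by move=> /FP[->|//] [].
  right; split.
  - by move=> p gp; exists X => //; have [+ _ _] := Fgood _ FX (proj1 (set0P _) X0); exact.
  - move=> a p q [X1 FX1 Xp] [X2 FX2 Xq].
    have [X12|X21] := Ftot _ _ FX1 FX2.
    + exists X2 => //; have [_ lin _] := Fgood _ FX2 (ex_intro _ _ Xq).
      by apply: lin => //; exact: X12.
    + exists X1 => //; have [_ lin _] := Fgood _ FX1 (ex_intro _ _ Xp).
      by apply: lin => //; exact: X21.
  - move=> p [X1 FX1 Xp]; have [_ _ pos] := Fgood _ FX1 (ex_intro _ _ Xp).
    exact: pos.
have gg : good g by split.
have hg : good h.
  case: hP => // h0; exfalso; apply: (hmax g); last by right.
  by rewrite h0; split=> [|/(_ _ g0)].
exists h => // v0 Wv0; apply: contrapT => nv0.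
have [t gt] := good_extend hg Wv0; apply: (hmax (extend h v0 t)); last by right.
split=> [[w r] hwr|]; first by exists (w, r) => //; exists 0; rewrite scale0r mul0r !addr0.
move=> /(_ (v0, t)) ht; apply: nv0; exists t; apply: ht.
have [gh _ _] := hg; exists (0, 0); first exact: gh.
by exists 1; rewrite scale1r mul1r !add0r.
Qed.

Hypothesis WD : forall a x y, W x -> W y -> W (a *: x + y).
Hypothesis C0 : C 0.

(** Two values of the maximal graph at the same vector differ by a value at 0; as [C 0] holds, both
    this difference and its opposite are nonnegative. Outside the domain of the graph [l] has the
    default value 0, so linearity and positivity are claimed on [W] only. *)
Lemma riesz_extension : exists l : V -> R,
  [/\ forall p, g p -> l p.1 = p.2,
      forall (a : R) x y, W x -> W y -> l (a *: x + y) = a * l x + l y &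
      forall x, W x -> C x -> 0 <= l x].
Proof.
have [h hg htot] := exists_total; have [gh hlin hpos] := hg.
have hfun v r s : h (v, r) -> h (v, s) -> r = s.
  move=> hr hs; apply/eqP; rewrite eq_le -subr_ge0 -[_ <= r]subr_ge0.
  have := hpos _ (goodB hg hr hs); have := hpos _ (goodB hg hs hr).
  by rewrite /= subrr => -> // ->.
pose l v := xget 0 [set r | h (v, r)].
have lE v r : h (v, r) -> l v = r.
  move=> hr; apply: (hfun v) => //.
  exact: (@xgetPex _ _ [set r | h (v, r)] (ex_intro _ r hr)).
exists l; split=> [[v r] /gh /lE //|a x y Wx Wy|x Wx Cx].
- have [[r hr] [s hs]] := (htot _ Wx, htot _ Wy).
  by rewrite (lE _ _ hr) (lE _ _ hs); apply: lE; exact: (hlin a _ _ hr hs).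
- by have [r hr] := htot _ Wx; rewrite (lE _ _ hr); exact: (hpos _ hr).
Qed.

End RieszExtension.

(** * Completion of a semi-inner product space *)

Record semi_inner (R : realType) (E : lmodType R[i]) := SemiInner {
  semi_form :> E -> E -> R[i];
  semi_formP : forall z, scalar (semi_form^~ z);
  semi_formC : forall x y, semi_form x y = (semi_form y x)^*;
  semi_form_ge0 : forall x, 0 <= semi_form x x
}.

Section SemiInner.
Context {R : realType} {E : lmodType R[i]}.
Variable s : semi_inner E.
Implicit Types (x y z : E) (a : R[i]).

Lemma semi_formDl x y z : s (x + y) z = s x z + s y z.
Proof. by rewrite -[x in LHS]scale1r semi_formP mul1r. Qed.

Lemma semi_form0l z : s 0 z = 0.
Proof. by apply: (addrI (s 0 z)); rewrite -semi_formDl !addr0. Qed.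

Lemma semi_formZl a x z : s (a *: x) z = a * s x z.
Proof. by rewrite -[a *: x]addr0 semi_formP semi_form0l addr0. Qed.

Lemma semi_formBl x y z : s (x - y) z = s x z - s y z.
Proof. by rewrite semi_formDl -scaleN1r semi_formZl mulN1r. Qed.

Lemma semi_formDr x y z : s z (x + y) = s z x + s z y.
Proof. by rewrite !(semi_formC s z) semi_formDl rmorphD. Qed.

Lemma semi_formBr x y z : s z (x - y) = s z x - s z y.
Proof. by rewrite !(semi_formC s z) semi_formBl rmorphB. Qed.

Lemma semi_formZr a x z : s z (a *: x) = a^* * s z x.
Proof. by rewrite !(semi_formC s z) semi_formZl rmorphM. Qed.

(** Positivity at [s v v *: u - s u v *: v] gives the inequality multiplied by [s v v]. The form may
    be degenerate: if both vectors are null, the square of [x - s x y *: y] equals -2 |s x y|^2,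
    which forces [s x y] to vanish. *)
Lemma semi_CauchySchwarz x y : `|s x y| ^+ 2 <= s x x * s y y.
Proof.
have key u v : s v v * (s u u * s v v - `|s u v| ^+ 2) >= 0.
  have := semi_form_ge0 s (s v v *: u - s u v *: v).
  rewrite semi_formBl !semi_formBr !semi_formZl !semi_formZr.
  rewrite (semi_formC s v u) normCK (geC0_conj (semi_form_ge0 s v)).
  by congr (0 <= _); ring.
have pos u v : 0 < s v v -> `|s u v| ^+ 2 <= s u u * s v v.
  by move=> v0; have := key u v; rewrite pmulr_rge0 // subr_ge0.
have [y0|yn0] := eqVneq (s y y) 0; last by apply: pos; rewrite lt_def yn0 semi_form_ge0.
have [x0|xn0] := eqVneq (s x x) 0; last first.
  rewrite semi_formC norm_conjC mulrC.
  by apply: pos; rewrite lt_def xn0 semi_form_ge0.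
have := semi_form_ge0 s (x - s x y *: y).
rewrite semi_formBl !semi_formBr !semi_formZl !semi_formZr x0 y0.
rewrite (semi_formC s y x) !mulr0 sub0r subr0 [_^* * _]mulrC -normCK -opprD oppr_ge0.
by rewrite -mulr2n pmulrn_lle0.
Qed.

Definition semi_norm x : R[i] := sqrtC (s x x).

Lemma semi_norm_ge0 x : 0 <= semi_norm x.
Proof. by rewrite sqrtC_ge0 semi_form_ge0. Qed.

Lemma semi_normK x : semi_norm x ^+ 2 = s x x.
Proof. exact: sqrtCK. Qed.

Lemma le_semi_form x y : `|s x y| <= semi_norm x * semi_norm y.
Proof.
rewrite -ler_sqr ?nnegrE ?mulr_ge0 ?semi_norm_ge0 //.
by rewrite exprMn !semi_normK semi_CauchySchwarz.
Qed.

Lemma semi_normZ a x : semi_norm (a *: x) = `|a| * semi_norm x.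
Proof.
rewrite /semi_norm semi_formZl semi_formZr mulrA -normCK.
by rewrite rootCMl ?exprn_ge0 // sqrCK.
Qed.

Lemma ler_semi_normD x y : semi_norm (x + y) <= semi_norm x + semi_norm y.
Proof.
rewrite -ler_sqr ?nnegrE ?addr_ge0 ?semi_norm_ge0 //.
rewrite sqrrD !semi_normK semi_formDl !semi_formDr (semi_formC s y x).
set d := s x y.
have dE : d + d^* <= semi_norm x * semi_norm y *+ 2.
  have dR : d + d^* \is Num.real by rewrite CrealE rmorphD /= conjCK addrC.
  rewrite (le_trans (real_ler_norm dR)) // (le_trans (ler_normD _ _)) //.
  by rewrite norm_conjC -mulr2n lerMn2r le_semi_form.
rewrite -subr_ge0 in dE; rewrite -subr_ge0; congr (0 <= _): dE; ring.
Qed.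

Lemma semi_normN x : semi_norm (- x) = semi_norm x.
Proof. by rewrite -scaleN1r semi_normZ normrN1 mul1r. Qed.

End SemiInner.

(** * Limits of complex sequences *)

Section ComplexSequences.
Context {R : realType}.
Implicit Types (u v : nat -> R[i]) (l a e : R[i]).

(* [R[i]] carries no canonical topology (only [R[i]^o] does). *)
Definition complex_cvg u l :=
  forall e, 0 < e -> exists N, forall n, (N <= n)%N -> `|u n - l| <= e.

Definition cauchy_bound (d : nat -> nat -> R[i]) :=
  forall e, 0 < e -> exists N, forall m n, (N <= m)%N -> (N <= n)%N -> d m n <= e.

Lemma complex_cvg_cst l : complex_cvg (fun=> l) l.
Proof. by move=> e e0; exists 0%N => n _; rewrite subrr normr0 ltW. Qed.

Lemma complex_cvg_ext u v l : u =1 v -> complex_cvg u l -> complex_cvg v l.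
Proof. by move=> uv ul e /ul[N Nu]; exists N => n; rewrite -uv; exact: Nu. Qed.

Lemma complex_cvg_comb a u v l l' : complex_cvg u l -> complex_cvg v l' ->
  complex_cvg (fun n => a * u n + v n) (a * l + l').
Proof.
move=> ul vl e e0; have a0 : 0 < `|a| + 1 by rewrite ltr_wpDl.
have e1 : 0 < e / (`|a| + 1) by rewrite divr_gt0.
have [[N1 H1] [N2 H2]] := (ul _ e1, vl _ e1).
exists (maxn N1 N2) => n; rewrite geq_max => /andP[/H1 {}H1 /H2 {}H2].
rewrite opprD addrACA -mulrBr (le_trans (ler_normD _ _)) // normrM.
rewrite (_ : e = `|a| * (e / (`|a| + 1)) + e / (`|a| + 1)).
  by rewrite lerD ?ler_wpM2l.
by field; rewrite gt_eqF.
Qed.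

Lemma complex_cvgD u v l l' : complex_cvg u l -> complex_cvg v l' ->
  complex_cvg (fun n => u n + v n) (l + l').
Proof.
move=> ul vl; have := complex_cvg_comb 1 ul vl; rewrite mul1r.
by apply: complex_cvg_ext => n; rewrite mul1r.
Qed.

Lemma complex_cvgM u v l l' : complex_cvg u l -> complex_cvg v l' ->
  complex_cvg (fun n => u n * v n) (l * l').
Proof.
move=> ul vl e e0; pose b := `|l| + (`|l'| + 1).
have b0 : 0 < b by rewrite ltr_wpDl // ltr_wpDl.
have eb0 : 0 < e / b by rewrite divr_gt0.
have [[N1 H1] [N2 H2] [N3 H3]] := And3 (ul _ eb0) (vl _ eb0) (vl _ ltr01).
exists (maxn N1 (maxn N2 N3)) => n.
rewrite !geq_max => /andP[/H1 {}H1 /andP[/H2 {}H2 /H3 {}H3]].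
have vb : `|v n| <= `|l'| + 1.
  by rewrite -[v n](subrK l') addrC (le_trans (ler_normD _ _)) // lerD2l.
have -> : u n * v n - l * l' = l * (v n - l') + (u n - l) * v n by ring.
rewrite (le_trans (ler_normD _ _)) // !normrM.
rewrite (_ : e = `|l| * (e / b) + e / b * (`|l'| + 1)).
  by rewrite lerD ?ler_wpM2l ?ler_pM.
by rewrite [e / b * _]mulrC -mulrDl -/b mulrC divfK ?gt_eqF.
Qed.

Lemma complex_cvg_prod (I : Type) (r : seq I) (u : I -> nat -> R[i]) (l : I -> R[i]) :
  (forall i, complex_cvg (u i) (l i)) ->
  complex_cvg (fun n => \prod_(i <- r) u i n) (\prod_(i <- r) l i).
Proof.
move=> ul; elim: r => [|i r IH].
  by rewrite big_nil; apply: complex_cvg_ext (complex_cvg_cst 1) => n; rewrite big_nil.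
rewrite big_cons; apply: complex_cvg_ext (complex_cvgM (ul i) IH) => n.
by rewrite big_cons.
Qed.

Lemma complex_cvg_sum (I : Type) (r : seq I) (u : I -> nat -> R[i]) (l : I -> R[i]) :
  (forall i, complex_cvg (u i) (l i)) ->
  complex_cvg (fun n => \sum_(i <- r) u i n) (\sum_(i <- r) l i).
Proof.
move=> ul; elim: r => [|i r IH].
  by rewrite big_nil; apply: complex_cvg_ext (complex_cvg_cst 0) => n; rewrite big_nil.
rewrite big_cons; apply: complex_cvg_ext (complex_cvgD (ul i) IH) => n.
by rewrite big_cons.
Qed.

Lemma eq_dist_le l l' : (forall e, 0 < e -> `|l - l'| <= e) -> l = l'.
Proof.
move=> ll; apply/eqP; rewrite -subr_eq0 -normr_eq0; apply: contraT => n0.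
have d0 : 0 < `|l - l'| by rewrite lt_def n0 normr_ge0.
have := ll (`|l - l'| / 2); rewrite divr_gt0 // => /(_ isT).
by rewrite ler_pdivlMr // ger_pMr // lern1.
Qed.

Lemma complex_cvg_unique u l l' : complex_cvg u l -> complex_cvg u l' -> l = l'.
Proof.
move=> ul ul'; apply: eq_dist_le => e e0.
have e2 : 0 < e / 2 by rewrite divr_gt0.
have [[N1 H1] [N2 H2]] := (ul _ e2, ul' _ e2).
have := H1 (maxn N1 N2) (leq_maxl _ _); have := H2 (maxn N1 N2) (leq_maxr _ _).
rewrite distrC => h2 h1; rewrite [e]splitr -[l](subrK (u (maxn N1 N2))) -addrA.
by rewrite (le_trans (ler_normD _ _)) // lerD // distrC // distrC.
Qed.

Lemma complex_cvg_conj u l : complex_cvg u l -> complex_cvg (fun n => (u n)^*) (l^*).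
Proof. by move=> ul e /ul[N Nu]; exists N => n /Nu; rewrite -rmorphB norm_conjC. Qed.

(** In the partial order the limit has to be real as well as nonnegative. Both are contained in |l|
    = l, which holds because u n = |u n| eventually, and |u n| tends to |l|. *)
Lemma complex_cvg_ge0 u l N : (forall n, (N <= n)%N -> 0 <= u n) ->
  complex_cvg u l -> 0 <= l.
Proof.
move=> u0 ul; suff <- : `|l| = l by [].
apply: complex_cvg_unique (ul) => e /ul[M Mu]; exists (maxn N M) => n.
rewrite geq_max => /andP[/u0 un0 /Mu]; apply: le_trans.
by rewrite -{1}(ger0_norm un0) ler_dist_dist.
Qed.

Lemma gt0_complex e : 0 < e -> exists2 r : R, 0 < r & e = r%:C%C.
Proof.
move=> e0; have eE : (complex.Re e)%:C%C = e by apply: RRe_real; exact: gtr0_real.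
by exists (complex.Re e); rewrite -?ltcR ?eE.
Qed.

Lemma exists_invn_le e : 0 < e -> exists N : nat, (N.+1)%:R^-1 <= e.
Proof.
move=> /gt0_complex[r r0 ->]; exists (Num.truncn r^-1).
rewrite -(rmorph_nat (real_complex R)) -fmorphV /= lecR.
rewrite -[leRHS]invrK lef_pV2 ?posrE ?invr_gt0 // ltW //.
by rewrite real_truncnS_gt // num_real.
Qed.

Lemma complex_cvg_invn : complex_cvg (fun n => n.+1%:R^-1) 0.
Proof.
move=> e /exists_invn_le[N Ne]; exists N => n Nn.
rewrite subr0 ger0_norm ?invr_ge0 // (le_trans _ Ne) //.
by rewrite lef_pV2 ?posrE ?ltr0n // ler_nat ltnS.
Qed.

Lemma cauchy_complex_cvg u : cauchy_bound (fun m n => `|u m - u n|) ->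
  exists l, complex_cvg u l.
Proof.
move=> uC.
(* Completeness of [R] is used for any real sequence whose increments are dominated by those of [u],
   then applied to the real and the imaginary part. *)
have cR (w : nat -> R) : (forall m n, `|w m - w n|%:C%C <= `|u m - u n|) ->
    exists l : R, forall e : R, 0 < e -> exists N, forall n, (N <= n)%N -> `|w n - l| <= e.
  move=> wu; have : cauchy (w @ \oo).
    apply: cauchy_exP => e e0.
    have [|N Nu] := uC (e / 2)%:C%C; first by rewrite ltcR divr_gt0.
    exists (w N), N => // n Nn; rewrite /ball /=.
    have := le_trans (wu N n) (Nu _ _ (leqnn N) Nn); rewrite lecR => /le_lt_trans; apply.
    by rewrite ltr_pdivrMr // ltr_pMr // ltr1n.
  move=> /cauchy_cvgP /cvg_ex[l /cvgrPdist_le wl].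
  exists l => e /wl[N _ Nw]; exists N => n Nn; rewrite distrC; exact: Nw.
have Im_le (z : R[i]) : `|complex.Im z|%:C%C <= `|z|.
  rewrite normc_def lecR -[leLHS]sqrtr_sqr ler_wsqrtr //.
  by rewrite lerDr sqr_ge0.
have [a Ha] : exists a : R, forall e : R, 0 < e ->
    exists N, forall n, (N <= n)%N -> `|complex.Re (u n) - a| <= e.
  by apply: cR => m n; rewrite -raddfB; exact: normc_ge_Re.
have [b Hb] : exists b : R, forall e : R, 0 < e ->
    exists N, forall n, (N <= n)%N -> `|complex.Im (u n) - b| <= e.
  by apply: cR => m n; rewrite -raddfB; exact: Im_le.
exists (Complex a b) => e /gt0_complex[r r0 ->].
have r20 : 0 < r / 2 by rewrite divr_gt0.
have [[N1 HN1] [N2 HN2]] := (Ha _ r20, Hb _ r20).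
exists (maxn N1 N2) => n; rewrite geq_max => /andP[/HN1 h1 /HN2 h2].
have -> : u n - Complex a b = (complex.Re (u n) - a)%:C%C + 'i%C * (complex.Im (u n) - b)%:C%C.
  by rewrite [LHS]complexE !raddfB.
rewrite (le_trans (ler_normD _ _)) // normrM !normc_def /=.
rewrite !expr0n /= !addr0 add0r expr1n sqrtr1 mul1r !sqrtr_sqr -rmorphD lecR /=.
by rewrite [r]splitr lerD.
Qed.

End ComplexSequences.

(** * Cauchy sequences and their weak limits *)

Section Completion.
Context {R : realType} {E : lmodType R[i]}.
Variable s : semi_inner E.
Implicit Types (u v : nat -> E) (F G : E -> R[i]) (e : R[i]).

Definition semi_cauchy u := cauchy_bound (fun m n => semi_norm s (u m - u n)).

Lemma semi_cauchy_bounded u : semi_cauchy u ->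
  exists2 B, 0 < B & exists N, forall n, (N <= n)%N -> semi_norm s (u n) <= B.
Proof.
move=> /(_ 1 ltr01)[N Nu]; exists (1 + semi_norm s (u N)).
  by rewrite ltr_wpDr ?semi_norm_ge0.
exists N => n Nn; rewrite -[u n](subrK (u N)).
by rewrite (le_trans (ler_semi_normD _ _ _)) // lerD2r Nu.
Qed.

Lemma semi_cauchy_cst x : semi_cauchy (fun=> x).
Proof.
move=> e e0; exists 0%N => m n _ _.
by rewrite subrr /semi_norm semi_form0l sqrtC0 ltW.
Qed.

Lemma semi_cauchyP a u v : semi_cauchy u -> semi_cauchy v ->
  semi_cauchy (fun n => a *: u n + v n).
Proof.
move=> uC vC e e0; have a0 : 0 < `|a| + 1 by rewrite ltr_wpDl.
have e1 : 0 < e / (`|a| + 1) by rewrite divr_gt0.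
have [[N1 H1] [N2 H2]] := (uC _ e1, vC _ e1).
exists (maxn N1 N2) => m n; rewrite !geq_max => /andP[m1 m2] /andP[n1 n2].
rewrite opprD addrACA -scalerBr (le_trans (ler_semi_normD _ _ _)) // semi_normZ.
rewrite (_ : e = `|a| * (e / (`|a| + 1)) + e / (`|a| + 1)).
  by rewrite lerD ?ler_wpM2l ?H1 ?H2.
by field; rewrite gt_eqF.
Qed.

Lemma semi_cauchy_pair_cvg u v : semi_cauchy u -> semi_cauchy v ->
  exists l : R[i], complex_cvg (fun n => s (u n) (v n)) l.
Proof.
move=> uC vC; apply: cauchy_complex_cvg => e e0.
have [[B B0 [N BN]] [B' B'0 [N' BN']]] :=
  (semi_cauchy_bounded uC, semi_cauchy_bounded vC).
have BB0 : 0 < B + B' by rewrite addr_gt0.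
have e1 : 0 < e / (B + B') by rewrite divr_gt0.
have [[N1 H1] [N2 H2]] := (uC _ e1, vC _ e1).
exists (maxn (maxn N N') (maxn N1 N2)) => m n.
rewrite !geq_max => /andP[/andP[m1 m2] /andP[m3 m4]] /andP[/andP[n1 n2] /andP[n3 n4]].
have -> : s (u m) (v m) - s (u n) (v n) = s (u m - u n) (v m) + s (u n) (v m - v n).
  by rewrite semi_formBl semi_formBr; ring.
rewrite (_ : e = e / (B + B') * B' + B * (e / (B + B'))); last by field; rewrite gt_eqF.
rewrite (le_trans (ler_normD _ _)) // lerD // (le_trans (le_semi_form _ _ _)) //.
  by rewrite ler_pM ?semi_norm_ge0 ?H1 ?BN'.
by rewrite ler_pM ?semi_norm_ge0 ?BN ?H2.
Qed.

Definition represents u F := semi_cauchy u /\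
  forall y, complex_cvg (fun n => s (u n) y) (F y).

Lemma represents_cst x : represents (fun=> x) (s x).
Proof. by split=> [|y]; [exact: semi_cauchy_cst|exact: complex_cvg_cst]. Qed.

Lemma representsP a u v F G : represents u F -> represents v G ->
  represents (fun n => a *: u n + v n) (a *: F + G).
Proof.
move=> [uC uF] [vC vG]; split=> [|y]; first exact: semi_cauchyP.
apply: complex_cvg_ext (complex_cvg_comb a (uF y) (vG y)) => n.
by rewrite semi_formP.
Qed.

(** For Cauchy sequences weak convergence to 0 implies convergence in norm. With a late term [u M]
    frozen, s (u n) (u n) = s (u n) (u n - u M) + s (u n) (u M); the first summand is small since
    [u] is Cauchy and bounded, the second by weak convergence. *)
Lemma represents0_norm u : represents u (fun=> 0) ->
  complex_cvg (fun n => s (u n) (u n)) (0).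
Proof.
move=> [uC u0]; have [B B0 [N BN]] := semi_cauchy_bounded uC.
move=> e e0.
have [|N1 H1] := uC (e / 2 / B); first by rewrite !divr_gt0.
pose M := maxn N N1; have [|N2 H2] := u0 (u M) (e / 2).
  by rewrite divr_gt0.
exists (maxn M N2) => n; rewrite !geq_max => /andP[/andP[nN nN1] /H2].
rewrite !subr0 => {}H2; rewrite -{2}[u n](subrK (u M)) semi_formDr addrC.
rewrite (le_trans (ler_normD _ _)) // [e]splitr lerD // (le_trans (le_semi_form _ _ _)) //.
rewrite (_ : e / 2 = B * (e / 2 / B)); last by field; rewrite gt_eqF.
by rewrite ler_pM ?semi_norm_ge0 ?BN ?H1 ?leq_maxr.
Qed.

Lemma represents0_pair u v : represents u (fun=> 0) -> semi_cauchy v ->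
  complex_cvg (fun n => s (u n) (v n)) (0).
Proof.
move=> /represents0_norm u0 /semi_cauchy_bounded[B B0 [N BN]].
move=> e e0.
have [|N1 H1] := u0 ((e / B) ^+ 2).
  by rewrite exprn_gt0 // divr_gt0.
exists (maxn N N1) => n; rewrite geq_max => /andP[nN /H1].
rewrite !subr0 -semi_normK normrX ler_sqr ?nnegrE ?(ltW (divr_gt0 _ _)) //.
rewrite ger0_norm ?semi_norm_ge0 // => {}H1.
have eE : e = e / B * B by rewrite divfK ?gt_eqF.
by rewrite (le_trans (le_semi_form _ _ _)) // eE ler_pM ?semi_norm_ge0 ?BN.
Qed.

(** This makes the inner product of the completion independent of the chosen representatives: they
    differ by null sequences, whose pairings with Cauchy sequences vanish in the limit. *)
Lemma represents_pair_unique u u' v v' F G (l : R[i]) :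
  represents u F -> represents u' F -> represents v G -> represents v' G ->
  complex_cvg (fun n => s (u n) (v n)) l ->
  complex_cvg (fun n => s (u' n) (v' n)) l.
Proof.
move=> uF u'F vG v'G uvl.
have sub w w' D : represents w D -> represents w' D ->
    represents (fun n => -1 *: w n + w' n) (fun=> 0).
  move=> wD w'D; have := representsP (-1) wD w'D.
  by rewrite scaleN1r addNr.
have h1 := represents0_pair (sub _ _ _ uF u'F) v'G.1.
have h2 := represents0_pair (sub _ _ _ vG v'G) uF.1.
have := complex_cvgD (complex_cvgD uvl h1) (complex_cvg_conj h2).
rewrite conjC0 !addr0; apply: complex_cvg_ext => n; rewrite -semi_formC.
by rewrite !semi_formP semi_formDr semi_formZr rmorphN1; ring.
Qed.

End Completion.

(** * The Hilbert space completion *)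

Section CompletionSpace.
Context {R : realType} {E : lmodType R[i]}.
Variable s : semi_inner E.

(* The completion is realized by the functions [y |-> lim_n s (u n) y], where [u]
   is Cauchy; since such a function determines [u] up to a null sequence, no
   quotient has to be formed. *)
Definition completion_pred : {pred E -> R[i]} :=
  fun F => `[< exists u, represents s u F >].

Lemma completion_pred_submod : submod_closed completion_pred.
Proof.
split=> [|a F G /asboolP[u uF] /asboolP[v vG]]; apply/asboolP.
  exists (fun=> 0); split=> [|y]; first exact: semi_cauchy_cst.
  by rewrite semi_form0l; exact: complex_cvg_cst.
by exists (fun n => a *: u n + v n); exact: representsP.
Qed.

HB.instance Definition _ := GRing.isSubmodClosed.Build _ _ completion_pred
  completion_pred_submod.

Record completion := Completion {
  completion_val :> E -> R[i];
  _ : completion_val \in completion_pred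
}.

HB.instance Definition _ := [isSub for completion_val].

HB.instance Definition _ := [Choice of completion by <:].

HB.instance Definition _ := [SubChoice_isSubLmodule of completion by <:].

Lemma completionP (F : completion) : exists u, represents s u F.
Proof. exact/asboolP/(valP F). Qed.

Lemma completion_ext (F G : completion) : (forall y, F y = G y) -> F = G.
Proof. by move=> FG; apply/val_inj/funext. Qed.

Lemma completion_comb a (F G : completion) y : (a *: F + G) y = a * F y + G y.
Proof. by []. Qed.

Definition completion_rep (F : completion) : nat -> E :=
  xget (fun=> 0) [set u | represents s u F].

Lemma completion_repP F : represents s (completion_rep F) F.
Proof. exact: (@xgetPex _ _ [set u | represents s u F] (completionP F)). Qed.

Definition completion_inner (F G : completion) : R[i] :=
  xget 0 [set l | complex_cvg (fun n => s (completion_rep F n) (completion_rep G n)) l].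

Lemma completion_inner_cvg (F G : completion) u v :
  represents s u F -> represents s v G ->
  complex_cvg (fun n => s (u n) (v n)) (completion_inner F G).
Proof.
move=> uF vG; apply: represents_pair_unique (completion_repP F) uF (completion_repP G) vG _.
have := semi_cauchy_pair_cvg (completion_repP F).1 (completion_repP G).1.
exact: (@xgetPex _ _ [set l | complex_cvg _ l]).
Qed.

Lemma completion_innerC F G : completion_inner F G = (completion_inner G F)^*.
Proof.
have h1 := completion_inner_cvg (completion_repP F) (completion_repP G).
have h2 := completion_inner_cvg (completion_repP G) (completion_repP F).
apply: complex_cvg_unique h1 _; apply: complex_cvg_ext (complex_cvg_conj h2) => n.
by rewrite -semi_formC.
Qed.

Lemma completion_innerP G : scalar (completion_inner^~ G).
Proof.
move=> a F F'.
have [hF hF' hG] := And3 (completion_repP F) (completion_repP F') (completion_repP G).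
have h := completion_inner_cvg (F := a *: F + F') (representsP a hF hF') hG.
apply: complex_cvg_unique h _.
have hc := complex_cvg_comb a (completion_inner_cvg hF hG) (completion_inner_cvg hF' hG).
by apply: complex_cvg_ext hc => n; rewrite semi_formP.
Qed.

Lemma completion_inner_ge0 F : 0 <= completion_inner F F.
Proof.
apply: (complex_cvg_ge0 (N := 0)) (completion_inner_cvg (completion_repP F) (completion_repP F)).
by move=> n _; exact: semi_form_ge0.
Qed.

Definition completion_semi_inner :=
  SemiInner completion_innerP completion_innerC completion_inner_ge0.

Lemma completion_embed_proof x : (fun y => s x y) \in completion_pred.
Proof. by apply/asboolP; exists (fun=> x); exact: represents_cst. Qed.

Definition completion_embed x : completion := Completion (completion_embed_proof x).

Lemma completion_embed_linear : linear completion_embed.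
Proof. by move=> a x y; apply: completion_ext => z; rewrite completion_comb /= semi_formP. Qed.

HB.instance Definition _ := GRing.isLinear.Build _ _ _ _ completion_embed completion_embed_linear.

Lemma completion_inner_embed F y : completion_inner F (completion_embed y) = F y.
Proof.
have h := completion_inner_cvg (G := completion_embed y) (completion_repP F) (represents_cst s y).
exact: complex_cvg_unique h ((completion_repP F).2 y).
Qed.

(** By Cauchy-Schwarz [F] is orthogonal to all embedded vectors, and these inner products are the
    values of [F]. *)
Lemma completion_inner_eq0 F : completion_inner F F = 0 -> F = 0.
Proof.
move=> F0; apply: completion_ext => y; rewrite [RHS]/=.
apply/eqP; rewrite -(completion_inner_embed F y) -normr_eq0 -sqrf_eq0 eq_le.
rewrite exprn_ge0 // andbT.
rewrite -[leRHS](mul0r (completion_inner (completion_embed y) (completion_embed y))) -F0.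
exact: (semi_CauchySchwarz completion_semi_inner).
Qed.

Definition completion_norm : completion -> R[i] := semi_norm completion_semi_inner.

Lemma completion_norm_eq0 F : completion_norm F = 0 -> F = 0.
Proof.
move=> F0; apply: completion_inner_eq0.
by have := semi_normK completion_semi_inner F; rewrite -/completion_norm F0 expr0n.
Qed.

HB.instance Definition _ := Lmodule_isNormed.Build R[i] completion
  (ler_semi_normD completion_semi_inner) (semi_normZ completion_semi_inner)
  completion_norm_eq0.

Lemma completion_normE (F : completion) : `|F| = sqrtC (completion_inner F F).
Proof. by []. Qed.

Lemma completion_embed_norm x : `|completion_embed x| = semi_norm s x.
Proof. by rewrite completion_normE completion_inner_embed. Qed.

Lemma completion_dist_le u (F : completion) x N (e : R[i]) : represents s u F -> 0 <= e ->
  (forall n, (N <= n)%N -> semi_norm s (u n - x) <= e) ->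
  `|F - completion_embed x| <= e.
Proof.
move=> uF e0 ue.
have rF : represents s (fun n => -1 *: x + u n) (F - completion_embed x).
  have -> : F - completion_embed x = -1 *: completion_embed x + F.
    by rewrite scaleN1r addrC.
  exact: (representsP (-1) (represents_cst s x) uF).
have h := completion_inner_cvg rF rF.
rewrite completion_normE -ler_sqr ?nnegrE ?sqrtC_ge0 ?completion_inner_ge0 //.
rewrite sqrtCK -subr_ge0 addrC -mulN1r.
apply: (complex_cvg_ge0 (N := N)) (complex_cvg_comb (-1) h (complex_cvg_cst (e ^+ 2))).
move=> n Nn; rewrite mulN1r addrC subr_ge0 -semi_normK scaleN1r addrC.
by rewrite ler_sqr ?nnegrE ?semi_norm_ge0 ?ue.
Qed.

Lemma completion_dense (F : completion) (e : R[i]) : 0 < e ->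
  exists x, `|F - completion_embed x| <= e.
Proof.
move=> e0; have [u uF] := completionP F; have [N uN] := uF.1 _ e0.
exists (u N); apply: (completion_dist_le (N := N)) uF (ltW e0) _ => n Nn.
exact: uN.
Qed.

(** The Cauchy filter is followed by embedded vectors [u n]. They form a Cauchy sequence in [E], and
    the function represented by this sequence is the limit of the filter. *)
Lemma completion_complete (Fs : set_system completion) :
  ProperFilter Fs -> cauchy Fs -> cvg Fs.
Proof.
move=> FsP /cauchyP Fscauchy.
(* One summand is the radius of a ball in the filter, the other the error of replacing its centre by
   an embedded vector. *)
pose r n : R[i] := n.+1%:R^-1 + n.+1%:R^-1.
have r0 n : 0 < n.+1%:R^-1 :> R[i] by rewrite invr_gt0 ltr0n.
have /(@choice nat)[u uP] : forall n, exists x, Fs (ball (completion_embed x) (r n)).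
  move=> n; have [G FsG] := Fscauchy _ (r0 n).
  have [x xG] := completion_dense G (r0 n).
  exists x; apply: filterS FsG => F; rewrite -!ball_normE /= => GF.
  rewrite -[_ - F](subrKA G) (le_lt_trans (ler_normD _ _)) //.
  by rewrite ler_ltD // distrC.
have rle e : 0 < e -> exists N, forall n, (N <= n)%N -> r n <= e.
  move=> e0; have [|N Ne] := @exists_invn_le R (e / 2); first by rewrite divr_gt0.
  exists N => n Nn; rewrite [e]splitr; have : n.+1%:R^-1 <= e / 2.
    by apply: le_trans Ne; rewrite lef_pV2 ?posrE ?ltr0n // ler_nat ltnS.
  by move=> h; rewrite lerD.
have uC : semi_cauchy s u.
  move=> e e0; have [|N Nr] := rle (e / 2); first by rewrite divr_gt0.
  exists N => m n Nm Nn; rewrite -completion_embed_norm raddfB /=.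
  have [F [+ +]] := filter_ex (filterI (uP m) (uP n)).
  rewrite -!ball_normE /= => mF nF.
  rewrite -[_ - completion_embed _](subrKA F) (le_trans (ler_normD _ _)) // [e]splitr.
  rewrite [X in _ + X]distrC.
  apply: lerD; [exact: (le_trans (ltW mF) (Nr _ Nm))|].
  exact: (le_trans (ltW nF) (Nr _ Nn)).
have /choice[L LP] y : exists l, complex_cvg (fun n => s (u n) y) l.
  exact: (semi_cauchy_pair_cvg uC (semi_cauchy_cst s y)).
have Lin : L \in completion_pred by apply/asboolP; exists u.
apply/cvg_ex; exists (Completion Lin); apply/cvg_ballP => e e0.
have e2 : 0 < e / 2 by rewrite divr_gt0.
have [[N uN] [M rM]] := (uC _ e2, rle _ e2).
pose n := maxn N M.
have Ln : `|Completion Lin - completion_embed (u n)| <= e / 2.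
  apply: (completion_dist_le (u := u) (N := N)) => //; first exact: ltW.
  by move=> m Nm; rewrite uN // leq_maxl.
apply: filterS (uP n) => F; rewrite -!ball_normE /= => nF.
rewrite -[_ - F](subrKA (completion_embed (u n))) (le_lt_trans (ler_normD _ _)) //.
rewrite [e]splitr; apply: ler_ltD; first exact: Ln.
by apply: (lt_le_trans nF); apply: rM; exact: leq_maxr.
Qed.

HB.instance Definition _ := Uniform_isComplete.Build completion completion_complete.

Let completion_inner_bilinear : bilinear_for *%R (Num.conj \; *%R) completion_inner.
Proof.
split=> [F|F]; first exact: completion_innerP.
move=> a G G'; rewrite !(completion_innerC F) completion_innerP.
by rewrite rmorphD rmorphM.
Qed.

HB.instance Definition _ := bilinear_isBilinear.Build R[i] completion completion R[i]
  *%R (Num.conj \; *%R) completion_inner completion_inner_bilinear.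

Let completion_inner_hermitian F G :
  completion_inner F G = (-1) ^+ false * (completion_inner G F)^*.
Proof. by rewrite expr0 mul1r completion_innerC. Qed.

HB.instance Definition _ := isHermitianSesquilinear.Build R[i] completion false Num.conj
  completion_inner completion_inner_hermitian.

Let completion_inner_gt0 F : F != 0 -> 0 < completion_inner F F.
Proof.
move=> F0; rewrite lt_def completion_inner_ge0 andbT.
by apply: contra F0 => /eqP/completion_inner_eq0/eqP.
Qed.

HB.instance Definition _ :=
  isDotProduct.Build R[i] completion completion_inner completion_inner_gt0.

Let completion_innerE F : completion_inner F F = `|F| ^+ 2.
Proof. by rewrite completion_normE sqrtCK. Qed.

HB.instance Definition _ := CompleteNormedModule_isHilbert.Build R completion completion_innerE.

End CompletionSpace.


Lemma adjE (R : realType) (H : hilbertType R) (A : {linear H -> H}) y w :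
  (forall x, inner (A x) y = inner x w) -> adj A y = w.
Proof.
move=> wP; have := @xgetPex _ 0 [set w | forall x, inner (A x) y = inner x w].
move=> /(_ (ex_intro _ w wP)) adjP; apply: inner_eq => z.
by rewrite innerC [RHS]innerC -wP -adjP.
Qed.

(** * Unitary operators on the completion *)

Section CompletionUnitary.
Context {R : realType} {E : lmodType R[i]}.
Variables (s : semi_inner E) (V V' : {linear E -> E}).
Hypothesis V'K : cancel V' V.
Hypothesis Viso : forall x y, s (V x) (V y) = s x y.

(** As s (V x) y = s x (V' y), applying [V] along a sequence amounts to precomposing the represented
    function with [V']. This is how [V] acts on the completion. *)
Lemma represents_comp u F : represents s u F -> represents s (V \o u) (F \o V').
Proof.
move=> [uC uF]; split=> [e /uC[N Nu]|y].
  by exists N => m n Nm Nn; rewrite /= -raddfB /semi_norm Viso; exact: Nu.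
by apply: complex_cvg_ext (uF (V' y)) => n; rewrite -Viso V'K.
Qed.

Lemma completion_lift_proof (F : completion s) : F \o V' \in completion_pred s.
Proof. by apply/asboolP; have [u /represents_comp] := completionP F; exists (V \o u). Qed.

Definition completion_lift (F : completion s) := Completion (completion_lift_proof F).

Lemma completion_lift_linear : linear completion_lift.
Proof. by move=> a F G; exact: completion_ext. Qed.

HB.instance Definition _ :=
  GRing.isLinear.Build _ _ _ _ completion_lift completion_lift_linear.

Lemma completion_lift_embed x :
  completion_lift (completion_embed s x) = completion_embed s (V x).
Proof. by apply: completion_ext => y; rewrite /= -Viso V'K. Qed.

End CompletionUnitary.

Lemma completion_lift_adj (R : realType) (E : lmodType R[i]) (s : semi_inner E)
    (V V' : {linear E -> E}) (VK : cancel V V') (V'K : cancel V' V)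
    (Viso : forall x y, s (V x) (V y) = s x y)
    (V'iso : forall x y, s (V' x) (V' y) = s x y) F G :
  inner (completion_lift V'K Viso F) G = inner F (completion_lift VK V'iso G).
Proof.
have [uF vG] := (completion_repP F, completion_repP G).
have h1 := completion_inner_cvg (F := completion_lift V'K Viso F)
  (represents_comp V'K Viso uF) vG.
have h2 := completion_inner_cvg (G := completion_lift VK V'iso G)
  uF (represents_comp VK V'iso vG).
apply: complex_cvg_unique h1 _; apply: complex_cvg_ext h2 => n /=.
by rewrite -Viso V'K.
Qed.

(** The lift of [V'] is at once the inverse and the adjoint of the lift of [V]. *)
Lemma completion_lift_unitary (R : realType) (E : lmodType R[i]) (s : semi_inner E)
    (V V' : {linear E -> E}) (VK : cancel V V') (V'K : cancel V' V)
    (Viso : forall x y, s (V x) (V y) = s x y) :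
  unitary_op (completion_lift V'K Viso).
Proof.
have V'iso x y : s (V' x) (V' y) = s x y by rewrite -Viso !V'K.
pose U := completion_lift V'K Viso; pose U' := completion_lift VK V'iso.
have UU' F : U (U' F) = F by apply: completion_ext => y /=; rewrite V'K.
have U'U F : U' (U F) = F by apply: completion_ext => y /=; rewrite VK.
have adjU G : adj U G = U' G by apply: adjE => F; exact: completion_lift_adj.
split=> [|F|F]; last 2 first.
- by rewrite /= adjU; exact: U'U.
- by rewrite /= adjU; exact: UU'.
exists 1 => F; rewrite mul1r !completion_normE.
suff -> : completion_inner (U F) (U F) = completion_inner F F by [].
by rewrite [LHS](completion_lift_adj VK V'K Viso V'iso) -/U' -/U U'U.
Qed.

(** * Projection onto the range of an isometry *)

Definition hilbert_semi_inner (R : realType) (H : hilbertType R) : semi_inner H :=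
  SemiInner (fun z a x y => linearPl inner z a x y) innerC (dnorm_ge0 inner).

Lemma parallelogram (R : realType) (H : hilbertType R) (x y : H) :
  inner (x + y) (x + y) + inner (x - y) (x - y) = (inner x x + inner y y) *+ 2.
Proof.
by rewrite !(innerBl, innerDl) !(innerBr, innerDr); ring.
Qed.

Lemma innerB_sqr (R : realType) (H : hilbertType R) (x y : H) (t : R[i]) :
  inner (x - t *: y) (x - t *: y) =
  inner x x - t^* * inner x y - t * (inner x y)^* + t * t^* * inner y y.
Proof.
by rewrite !(innerBl, innerBr, innerZl, innerZr) (innerC y x); ring.
Qed.

Section IsometryProjection.
Context {R : realType} {H K : hilbertType R}.
Variable J : {linear H -> K}.
Hypothesis Jiso : forall x, `|J x| = `|x|.

(** Polarization: the norm of a sum determines the real part of the inner product, and replacing [x]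
    by ['i *: x] then gives the imaginary part. *)
Lemma isometry_inner x y : inner (J x) (J y) = inner x y.
Proof.
have q z : inner (J z) (J z) = inner z z by rewrite !innerE Jiso.
have re u v : inner (J u) (J v) + inner (J v) (J u) = inner u v + inner v u.
  have := q (u + v); rewrite raddfD !innerDl !innerDr !q => h.
  by apply: (addrI (inner u u)); apply: (addIr (inner v v)); move: h; rewrite !addrA.
have := re ('i *: x) y; rewrite linearZ !innerZl !innerZr conjCi !mulNr.
rewrite -!mulrBr => /(mulfI (neq0Ci _)) im; have := re x y => re1.
have : (inner (J x) (J y)) *+ 2 = inner x y *+ 2.
  rewrite !mulr2n -[X in X + _](subrK (inner (J y) (J x))) im addrAC -addrA re1.
  by ring.
by move=> /eqP; rewrite eqrMn2r // => /orP[//|/eqP].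
Qed.

Let q y x : R := complex.Re (inner (y - J x) (y - J x)).

Let qE y x : (q y x)%:C%C = inner (y - J x) (y - J x).
Proof. by apply: RRe_real; apply: ger0_real; exact: dnorm_ge0. Qed.

(** A sequence minimizing the distance from [y] to the range is Cauchy by the parallelogram law.
    Orthogonality is first estimated at approximate minimizers and then passed to the limit. *)
Lemma isometry_projection y : exists x, forall z, inner (y - J x) (J z) = 0.
Proof.
pose S := range (q y); pose d := inf S.
have S0 : S !=set0 by exists (q y 0), 0.
have q0 x : 0 <= q y x by rewrite -lecR qE dnorm_ge0.
have Slb : has_lbound S by exists 0 => _ [x _ <-].
have dle x : d <= q y x by apply: ge_inf => //; exists x.
have /(@choice nat)[u uP] : forall n, exists x, q y x <= d + n.+1%:R^-1.
  move=> n; have [|_ [x _ <-] xd] := @inf_adherent _ S n.+1%:R^-1 _ (conj S0 Slb).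
    by rewrite invr_gt0 ltr0n.
  by exists x; exact: ltW.
(* This is the parallelogram law for [y - J x'] and [y - J x], with the distance at the midpoint [m]
   bounded below by [d]. *)
have half x x' : inner (x - x') (x - x') <=
    ((q y x - d) *+ 2 + (q y x' - d) *+ 2)%:C%C.
  pose m := 2^-1 *: (x + x').
  have mE : (y - J x') + (y - J x) = 2 *: (y - J m).
    rewrite scalerBr -linearZ /= /m scalerA divff ?pnatr_eq0 // scale1r linearD.
    by rewrite scaler_nat mulr2n addrACA -opprD [J x' + _]addrC.
  have := parallelogram (y - J x') (y - J x); rewrite mE.
  rewrite [y - J x' - _]addrC opprB subrKA.
  rewrite -linearB isometry_inner innerZl innerZr conjC_nat -!qE => h.
  have -> : inner (x - x') (x - x') = ((q y x' + q y x) *+ 2 - q y m *+ 4)%:C%C.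
    rewrite rmorphB rmorphMn rmorphD rmorphMn /= -h.
    by ring.
  by rewrite lecR; have := dle m; lra.
have uC e : 0 < e -> exists N, forall m n, (N <= m)%N -> (N <= n)%N -> `|u m - u n| <= e.
  (* By [half], the squared distance of two late terms is at most four times the excess 1/(N+1). *)
  move=> e0; have [|N Ne] := @exists_invn_le R (e ^+ 2 / 4).
    by rewrite divr_gt0 ?exprn_gt0 // ltr0n.
  exists N => m n Nm Nn; rewrite -ler_sqr ?nnegrE // ?(ltW e0) // -innerE.
  apply: (le_trans (half _ _)); rewrite -[e ^+ 2](divfK (x := 4)) ?pnatr_eq0 //.
  apply: (@le_trans _ _ (N.+1%:R^-1 * 4)%:C%C); last first.
    by rewrite rmorphM fmorphV !rmorph_nat ler_pM2r ?ltr0n.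
  have un k : (N <= k)%N -> q y (u k) <= d + N.+1%:R^-1.
    move=> Nk; apply: (le_trans (uP k)); rewrite lerD2l lef_pV2 ?posrE ?ltr0n //.
    by rewrite ler_nat ltnS.
  by rewrite lecR; move: (N.+1%:R^-1) (un _ Nm) (un _ Nn) => t; lra.
have /cauchy_cvgP/cvg_ex[x ux] : cauchy (u @ \oo).
  apply/cauchyP => e e0; have [|N Nu] := uC (e / 2); first by rewrite divr_gt0.
  exists (u N), N => // n Nn; rewrite -ball_normE /=.
  by rewrite (le_lt_trans (Nu _ _ _ _)) // ltr_pdivrMr // ltr_pMr // ltr1n.
(* Moving [w] by the optimal multiple of [z] lowers the squared distance by |<y - J w, J z>|^2 / <z,
   z>, which cannot exceed the excess over [d]. *)
have CS w z : `|inner (y - J w) (J z)| ^+ 2 <= (q y w - d)%:C%C * inner z z.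
  have [->|z0] := eqVneq z 0; first by rewrite linear0 !inner0r normr0 expr0n mulr0.
  have n0 : 0 < inner z z by rewrite dnorm_gt0.
  have := dle (w + (inner (y - J w) (J z) / inner z z) *: z).
  rewrite -lecR qE linearD linearZ opprD addrA.
  set c := inner _ (J z) .
  rewrite innerB_sqr isometry_inner -/c.
  rewrite rmorphM /= fmorphV /= (geC0_conj (ltW n0)) -(qE y w) => h.
  have {h} : 0 <= (q y w)%:C%C - d%:C%C - c * c^* / inner z z.
    by move: h; rewrite -subr_ge0; congr (0 <= _); field; rewrite gt_eqF.
  by rewrite -normCK subr_ge0 ler_pdivrMr // -rmorphB.
exists x => z; apply: (@eq_dist_le R) => e e0; rewrite subr0.
pose b := `|z| + 1; have b0 : 0 < b by rewrite ltr_wpDl.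
have zb : inner z z <= b ^+ 2 by rewrite innerE lerXn2r ?nnegrE ?(ltW b0) // lerDl.
have [|N Nb] := @exists_invn_le R ((e / 2 / b) ^+ 2).
  by rewrite exprn_gt0 // !divr_gt0.
have e20 : 0 < e / 2 by rewrite divr_gt0.
have e2b : 0 < e / 2 / b by rewrite !divr_gt0.
have [M _ Mu] := (cvgrPdist_le _ _).1 ux _ e2b; pose n := maxn N M.
have -> : y - J x = (y - J (u n)) - J (x - u n).
  by rewrite linearB opprB addrA subrK.
rewrite innerBl isometry_inner [e]splitr (le_trans (ler_normB _ _)) // lerD //.
  rewrite -ler_sqr ?nnegrE ?(ltW e20) // (le_trans (CS _ _)) //.
  rewrite -[e / 2](divfK (x := b)) ?gt_eqF // exprMn ler_pM ?dnorm_ge0 //.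
    by rewrite ler0c subr_ge0.
  apply: le_trans Nb; rewrite -(rmorph_nat (real_complex R)) -fmorphV /= lecR.
  rewrite lerBlDl (le_trans (uP n)) // lerD2l lef_pV2 ?posrE ?ltr0n //.
  by rewrite ler_nat ltnS leq_maxl.
have := semi_CauchySchwarz (hilbert_semi_inner H) (x - u n) z; rewrite /= => h.
rewrite -ler_sqr ?nnegrE ?(ltW e20) // (le_trans h) //.
rewrite -[e / 2](divfK (x := b)) ?gt_eqF // exprMn ler_pM ?dnorm_ge0 //.
rewrite innerE lerXn2r ?nnegrE ?(ltW e2b) //.
by apply: Mu; exact: leq_maxr.
Qed.

End IsometryProjection.

(** * Positivity for commuting unitaries *)

Section RootsOfUnity.
Variable C : numClosedFieldType.

(** In characteristic 0 the polynomial X^n - 1 is separable, so it has [n] distinct roots, and a set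
    of [n] distinct n-th roots of unity contains a primitive one. *)
Lemma closed_prim_root_exists n : (0 < n)%N -> exists z : C, n.-primitive_root z.
Proof.
move=> n0; pose p : {poly C} := 'X^n - 1.
have [r] := closed_field_poly_normal p.
rewrite (monicP (monicXnsubC 1 n0)) scale1r => pE.
have /hasP[z _ zn] : has n.-primitive_root r; last by exists z.
apply: has_prim_root => //; last by rewrite -ltnS -(size_prod_XsubC r id) -pE size_XnsubC.
  by apply/allP => z; rewrite -root_prod_XsubC -pE.
by rewrite -separable_prod_XsubC -pE separable_Xn_sub_1 // pnatr_eq0 -lt0n.
Qed.

Variables (M : nat) (w : C).
Hypothesis wM : M.-primitive_root w.

Lemma prim_root_norm : `|w| = 1.
Proof.
apply/eqP; rewrite -(@pexpr_eq1 _ _ M) ?(prim_order_gt0 wM) //.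
by rewrite -normrX (prim_expr_order wM) normr1.
Qed.

Lemma prim_root_exprz_eq1 (z : int) : (`|z| < M)%N -> (w ^ z == 1) = (z == 0).
Proof.
move=> zM; have wE (n : nat) : (n < M)%N -> (w ^+ n == 1) = (n == 0)%N.
  by move=> nM; rewrite -(prim_order_dvd wM); case: n nM => [|n] nM; rewrite ?dvdn0 ?gtnNdvd.
case: z zM => n nM; first by rewrite -exprnP wE.
by rewrite NegzE -exprz_inv -exprnP exprVn invr_eq1 wE.
Qed.

(** Orthogonality of characters by a geometric sum; the bound on [z] excludes nonzero multiples of
    [M]. *)
Lemma sum_prim_root_exprz (z : int) : (`|z| < M)%N ->
  \sum_(t < M) (w ^+ t) ^ z = if z == 0 then M%:R else 0.
Proof.
move=> zM; have wE (t : nat) : (w ^+ t) ^ z = (w ^ z) ^+ t.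
  by rewrite [in RHS]exprnP exprzAC -exprnP.
under eq_bigr do rewrite wE.
have [->|z0] := eqVneq z 0.
  by rewrite expr0z; under eq_bigr do rewrite expr1n; rewrite sumr_const card_ord.
have wz : w ^ z != 1 by rewrite prim_root_exprz_eq1.
apply: (mulfI (x := w ^ z - 1)); first by rewrite subr_eq0.
rewrite -subrX1 mulr0 [X in X - 1]exprnP exprzAC -exprnP (prim_expr_order wM).
by rewrite exp1rz subrr.
Qed.

End RootsOfUnity.

Lemma sum_eq_nat N m : (\sum_(b < N) (b == m :> nat) = (m < N))%N.
Proof.
elim: N => [|N IH]; first by rewrite big_ord0.
by rewrite big_ord_recr /= IH; lia.
Qed.

Lemma sum_ltn_nat N a : (\sum_(c < N) (a + c < N) = N - a)%N.
Proof.
suff H n : (\sum_(c < n) (a + c < N) = minn n (N - a))%N by rewrite H; lia.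
elim: n => [|n IH]; first by rewrite big_ord0 min0n.
by rewrite big_ord_recr /= IH; lia.
Qed.

(** The number of ways to write [z] as a difference of two elements of [0, N), which is [N] times a
    Fejer coefficient. *)
Definition fejer_count (N : nat) (z : int) : nat :=
  \sum_(b < N) \sum_(c < N) (b%:Z == z + c%:Z)%R.

Lemma fejer_countE N z : fejer_count N z = (N - `|z|)%N.
Proof.
rewrite /fejer_count; case: z => a.
  rewrite exchange_big -[RHS]sum_ltn_nat; apply: eq_bigr => c _.
  by rewrite -[RHS]sum_eq_nat; apply: eq_bigr => b _; congr (nat_of_bool _); lia.
rewrite -[RHS]sum_ltn_nat; apply: eq_bigr => b _.
by rewrite -[RHS]sum_eq_nat; apply: eq_bigr => c _; congr (nat_of_bool _); lia.
Qed.

Lemma fejer_count_cvg (R : realType) (z : int) :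
  complex_cvg (fun n => (fejer_count n.+1 z)%:R / n.+1%:R : R[i]) 1.
Proof.
have h := complex_cvg_comb (- `|z|%N%:R) (@complex_cvg_invn R) (complex_cvg_cst 1).
rewrite mulr0 add0r in h; move=> e e0; have [N Nu] := h e e0.
(* From |z| on, the truncated subtraction in [fejer_countE] is a true one. *)
exists (maxn N `|z|%N) => n; rewrite geq_max => /andP[/Nu h' zn].
rewrite fejer_countE natrB ?(leqW zn) // mulrBl divff ?pnatr_eq0 //.
by rewrite [1 - _ / _]addrC -mulNr.
Qed.

(** * Powers of commuting tuples *)

Section MultiPower.
Context {T : Type} {k : nat}.
Implicit Types (B : 'I_k -> T -> T) (b c : 'I_k -> nat).

(** [abs_power B al] is convertible to this at the exponents |al i|; free natural exponents can be
    added and split. *)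
Definition multi_power B b : T -> T :=
  \big[(fun f g => f \o g)/id]_(i < k) iter (b i) (B i).

Lemma iter_comm (f g : T -> T) n x : (forall x, f (g x) = g (f x)) ->
  f (iter n g x) = iter n g (f x).
Proof. by move=> fg; elim: n => //= n IH; rewrite fg IH. Qed.

Lemma multi_powerD B b c x : (forall i j x, B i (B j x) = B j (B i x)) ->
  multi_power B (fun i => b i + c i)%N x = multi_power B b (multi_power B c x).
Proof.
move=> BC; rewrite /multi_power; elim: (index_enum _) => [|i r IH].
  by rewrite !big_nil.
rewrite !big_cons /= iterD IH; congr iter.
move: ((\big[_/_]_(j <- r) iter (c j) (B j)) x) => y.
elim/big_rec: (\big[_/_]_(j <- r) iter (b j) (B j)) => //= j g _ <-.
by rewrite iter_comm // => z; rewrite iter_comm.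
Qed.

Lemma eq_multi_power B b c : b =1 c -> multi_power B b = multi_power B c.
Proof. by move=> bc; apply: eq_bigr => i _; rewrite bc. Qed.

Lemma multi_power0 B : multi_power B (fun=> 0%N) = id.
Proof. by rewrite /multi_power; elim/big_rec: _ => // i g _ ->. Qed.

Variables (C : Type) (s : T -> T -> C).

(** Moving the factors to the other side reverses their order; commutation of the [B'] restores
    it. *)
Lemma multi_power_adj B B' b x y :
  (forall i j x, B' i (B' j x) = B' j (B' i x)) ->
  (forall i x y, s (B i x) y = s x (B' i y)) ->
  s (multi_power B b x) y = s x (multi_power B' b y).
Proof.
move=> BC Bs; rewrite /multi_power; elim: (index_enum _) x y => [|i r IH] x y.
  by rewrite !big_nil.
rewrite !big_cons /=; have -> z w n : s (iter n (B i) z) w = s z (iter n (B' i) w).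
  by elim: n z w => //= n IHn z w; rewrite Bs IHn -iterSr.
rewrite IH; congr (s _); elim/big_rec: _ => //= j g _ ->.
by rewrite [RHS]iter_comm // => z; rewrite iter_comm.
Qed.

Lemma multi_power_iso B b x y :
  (forall i x y, s (B i x) (B i y) = s x y) ->
  s (multi_power B b x) (multi_power B b y) = s x y.
Proof.
move=> Bs; rewrite /multi_power; elim/big_rec: _ => //= i g _ <-.
by elim: (b i) => //= n IH; rewrite Bs.
Qed.

End MultiPower.

Lemma unimodular_conj (C : numClosedFieldType) (z : C) : `|z| = 1 -> z^* = z^-1.
Proof. by move=> z1; rewrite invC_norm z1 expr1n invr1 mul1r. Qed.

(** In a finite frame reproducing all [g i], their Gram matrix is a sum over [u] of rank one
    matrices z_i conj(z_j) with z_i = <g_i, u>, and the hypothesis applies to each of them. *)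
Lemma schur_positivity (R : realType) (H : hilbertType R) m
    (P : 'I_m -> 'I_m -> R[i]) (g : 'I_m -> H) :
  (forall z : 'I_m -> R[i], 0 <= \sum_(i < m) \sum_(j < m) P i j * z i * (z j)^*) ->
  0 <= \sum_(i < m) \sum_(j < m) P i j * inner (g i) (g j).
Proof.
move=> Ppos; have [e eg] := finite_frame [seq g i | i <- enum 'I_m].
have gE i j : inner (g i) (g j) = \sum_(u <- e) inner (g i) u * (inner (g j) u)^*.
  rewrite -[in LHS](eg (g i)); last by rewrite map_f // mem_enum.
  by rewrite inner_suml; apply: eq_bigr => u _; rewrite innerZl [inner u _]innerC.
rewrite (_ : \sum_(i < m) _ =
    \sum_(u <- e) \sum_(i < m) \sum_(j < m) P i j * inner (g i) u * (inner (g j) u)^*).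
  by apply: sumr_ge0 => u _; exact: Ppos.
rewrite [RHS]exchange_big; apply: eq_bigr => i _.
rewrite [RHS]exchange_big; apply: eq_bigr => j _.
by rewrite gE mulr_sumr; apply: eq_bigr => u _; rewrite mulrA.
Qed.

Definition int_pos (z : int) : nat := if z is Posz n then n else 0%N.

Definition int_neg (z : int) : nat := if z is Negz n then n.+1 else 0%N.

Lemma int_pos_neg z : z = (int_pos z)%:Z - (int_neg z)%:Z.
Proof. by case: z => n /=; lia. Qed.

(** * Fejer averaging over roots of unity *)

Section Fejer.
Context {R : realType} {K : hilbertType R} {k : nat}.
Variable U : 'I_k -> K -> K.
Hypothesis UC : forall i j x, U i (U j x) = U j (U i x).
Hypothesis Uiso : forall i x y, inner (U i x) (U i y) = inner x y.

(* For commuting unitaries this is [inner (U^al x) y]; distributing the positive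
   and the negative part of [al] over both arguments avoids inverses. *)
Definition two_sided (al : {ffun 'I_k -> int}) (x y : K) : R[i] :=
  inner (multi_power U (fun l => int_pos (al l)) x)
        (multi_power U (fun l => int_neg (al l)) y).

(** Let p and n be the positive and negative parts of [al]. Applying the isometry U^n to both
    arguments on the left and U^c to both on the right leads to the same exponents, since n + b = c
    + p. *)
Lemma two_sidedE (al : {ffun 'I_k -> int}) (b c : 'I_k -> nat) x y :
  (forall l, (b l)%:Z = al l + (c l)%:Z) ->
  inner (multi_power U b x) (multi_power U c y) = two_sided al x y.
Proof.
move=> bc; pose p l := int_pos (al l); pose n l := int_neg (al l).
rewrite -(multi_power_iso n _ _ Uiso) -!multi_powerD //.
rewrite -[RHS](multi_power_iso c _ _ Uiso) -!multi_powerD //.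
have -> : multi_power U (fun l => n l + b l)%N = multi_power U (fun l => c l + p l)%N.
  by apply: eq_multi_power => l; have := bc l; rewrite (int_pos_neg (al l)) -/(p l) -/(n l); lia.
by have -> : multi_power U (fun l => n l + c l)%N = multi_power U (fun l => c l + n l)%N
  by apply: eq_multi_power => l; rewrite addnC.
Qed.

Variables (m : nat) (r : seq {ffun 'I_k -> int}).
Variables (a : 'I_m -> 'I_m -> {ffun 'I_k -> int} -> R[i]).
Hypothesis apos : forall (lam : 'I_k -> R[i]) (z : 'I_m -> R[i]), torus lam ->
  0 <= \sum_(i < m) \sum_(j < m) (\sum_(al <- r) a i j al * monomial lam al) * z i * (z j)^*.
Variable f : 'I_m -> K.

(* With [g t i = \sum_b conj (lam_t^b) U^b (f i)], [b] ranging over [0, N)^k, the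
   sum of [\sum_ij P_ij(lam_t) <g t i, g t j>] over all [lam_t] in the [M]-th roots
   of unity is nonnegative by Schur's product argument; as [M] exceeds all
   occurring frequencies, orthogonality of characters leaves [M^k] times the
   Fejer-weighted sum. *)
Lemma fejer_positivity_count N :
  0 <= \sum_(i < m) \sum_(j < m) \sum_(al <- r)
    a i j al * two_sided al (f i) (f j) * (\prod_(l < k) fejer_count N (al l))%:R.
Proof.
pose B := (\sum_(al <- r) \sum_(l < k) `|al l|)%N.
pose M := (B + N).+1.
have [w wM] := closed_prim_root_exists R[i] (ltn0Sn (B + N)).
pose lam (t : {ffun 'I_k -> 'I_M}) l := w ^+ t l.
have lamT t : torus (lam t) by move=> l; rewrite normrX (prim_root_norm wM) expr1n.
pose pw t (b : {ffun 'I_k -> 'I_N}) := \prod_(l < k) lam t l ^+ b l.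
pose Ub (b : {ffun 'I_k -> 'I_N}) := multi_power U (fun l => b l).
pose g t i := \sum_(b : {ffun 'I_k -> 'I_N}) (pw t b)^* *: Ub b (f i).
have gE t i j : inner (g t i) (g t j) =
    \sum_(b : {ffun 'I_k -> 'I_N}) \sum_(c : {ffun 'I_k -> 'I_N})
      (pw t b)^* * pw t c * inner (Ub b (f i)) (Ub c (f j)).
  rewrite inner_suml; apply: eq_bigr => b _; rewrite inner_sumr; apply: eq_bigr => c _.
  by rewrite innerZl innerZr conjCK mulrA.
have orth (al : {ffun 'I_k -> int}) (b c : {ffun 'I_k -> 'I_N}) : al \in r ->
    \sum_t monomial (lam t) al * ((pw t b)^* * pw t c) =
    \prod_(l < k) (if (b l)%:Z == al l + (c l)%:Z then M%:R else 0).
  move=> alr; rewrite (eq_bigr (fun t : {ffun 'I_k -> 'I_M} =>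
    \prod_(l < k) (w ^+ t l) ^ (al l + (c l)%:Z - (b l)%:Z))); last first.
    move=> t _; rewrite /monomial /pw rmorph_prod -!big_split; apply: eq_bigr => l _ /=.
    have l0 : lam t l \is a GRing.unit by rewrite unitfE -normr_eq0 lamT oner_eq0.
    rewrite rmorphXn /= unimodular_conj ?lamT // exprVn -[lam t l]/(w ^+ t l) in l0 *.
    by rewrite !exprzDr // -exprz_inv -!exprnP exprVn; ring.
  rewrite -(bigA_distr_bigA (fun l (t : 'I_M) => (w ^+ t) ^ (al l + (c l)%:Z - (b l)%:Z))).
  apply: eq_bigr => l _; rewrite (sum_prim_root_exprz wM).
    by congr (if _ then _ else _); apply/eqP/eqP; lia.
  have alB : (`|al l| <= B)%N.
    rewrite /B (big_rem al) //= (leq_trans _ (leq_addr _ _)) //.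
    by rewrite (bigD1 l) //= leq_addr.
  by have := ltn_ord (b l); have := ltn_ord (c l); rewrite /M; lia.
have : 0 <= \sum_t \sum_(i < m) \sum_(j < m)
    (\sum_(al <- r) a i j al * monomial (lam t) al) * inner (g t i) (g t j).
  by apply: sumr_ge0 => t _; apply: schur_positivity => z; exact: apos.
have M0 : 0 < M%:R ^+ k :> R[i] by rewrite exprn_gt0 // ltr0n.
move=> h; rewrite -(pmulr_rge0 _ M0); congr (0 <= _): h.
rewrite exchange_big mulr_sumr; apply: eq_bigr => i _.
rewrite exchange_big mulr_sumr; apply: eq_bigr => j _.
rewrite (eq_bigr (fun t => \sum_(al <- r) a i j al *
    (\sum_b \sum_c monomial (lam t) al * ((pw t b)^* * pw t c) *
      inner (Ub b (f i)) (Ub c (f j))))); last first.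
  move=> t _; rewrite mulr_suml; apply: eq_bigr => al _; rewrite -mulrA gE; congr (_ * _).
  rewrite mulr_sumr; apply: eq_bigr => b _.
  by rewrite mulr_sumr; apply: eq_bigr => c _; rewrite !mulrA.
rewrite exchange_big mulr_sumr; apply: eq_big_seq => al alr.
rewrite -mulr_sumr [RHS]mulrC -!mulrA; congr (_ * _).
rewrite exchange_big (eq_bigr (fun b : {ffun 'I_k -> 'I_N} => \sum_(c : {ffun 'I_k -> 'I_N})
    (\prod_(l < k) (if (b l)%:Z == al l + (c l)%:Z then M%:R else 0)) *
    two_sided al (f i) (f j))); last first.
  move=> b _; rewrite exchange_big; apply: eq_bigr => c _; rewrite -mulr_suml orth //.
  (* Only pairs with b = al + c survive, and for them the inner product depends on [al] alone. *)
  have [/forallP bc|] := boolP [forall l, (b l)%:Z == al l + (c l)%:Z].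
    by congr (_ * _); apply: two_sidedE => l; exact/eqP.
  by rewrite negb_forall => /existsP[l nbc]; rewrite (bigD1 l) //= (negPf nbc) !mul0r.
under eq_bigr do rewrite -mulr_suml.
rewrite -mulr_suml mulrC; congr (_ * _).
under eq_bigr => b _ do
  rewrite -(bigA_distr_bigA (fun l (c : 'I_N) => if (b l)%:Z == al l + c%:Z then M%:R else 0)).
rewrite -(bigA_distr_bigA (fun l (b : 'I_N) =>
  \sum_(c < N) if b%:Z == al l + c%:Z then M%:R else 0)).
rewrite natr_prod -[k in M%:R ^+ k]card_ord -prodr_const -big_split.
apply: eq_bigr => l _; rewrite /= /fejer_count natr_sum mulr_suml; apply: eq_bigr => b _.
rewrite natr_sum mulr_suml; apply: eq_bigr => c _.
by case: ifP => _; rewrite ?mul1r ?mul0r.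
Qed.

(** Division of the weighted inequality by N^k turns each weight into a product of Fejer
    coefficients, which tends to 1. Taking N = n + 1 avoids division by zero. *)
Lemma fejer_positivity :
  0 <= \sum_(i < m) \sum_(j < m) \sum_(al <- r) a i j al * two_sided al (f i) (f j).
Proof.
pose u n := \sum_(i < m) \sum_(j < m) \sum_(al <- r)
  a i j al * two_sided al (f i) (f j) * \prod_(l < k) ((fejer_count n.+1 (al l))%:R / n.+1%:R).
apply: (@complex_cvg_ge0 R u _ 0%N) => [n _|].
  rewrite (_ : u n = n.+1%:R^-1 ^+ k * \sum_(i < m) \sum_(j < m) \sum_(al <- r)
    a i j al * two_sided al (f i) (f j) * (\prod_(l < k) fejer_count n.+1 (al l))%:R).
    by rewrite mulr_ge0 ?exprn_ge0 ?invr_ge0 ?fejer_positivity_count.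
  rewrite mulr_sumr; apply: eq_bigr => i _; rewrite mulr_sumr; apply: eq_bigr => j _.
  rewrite mulr_sumr; apply: eq_bigr => al _; rewrite big_split /= prodr_const card_ord.
  by rewrite natr_prod [RHS]mulrC mulrA.
apply: complex_cvg_sum => i; apply: complex_cvg_sum => j; apply: complex_cvg_sum => al.
rewrite -[X in complex_cvg _ X]mulr1; apply: complex_cvgM; first exact: complex_cvg_cst.
have := complex_cvg_prod (index_enum _) (fun l : 'I_k => @fejer_count_cvg R (al l)).
by rewrite [X in complex_cvg _ X]big1.
Qed.

End Fejer.

(** One list serves all the systems [a i], so that finitely supported sums with different
    coefficients become sums over the same list and can be interchanged with other sums. *)
Lemma common_support (T : choiceType) (C : nmodType) (I : finType) (D : set T) (a : I -> T -> C) :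
  (forall i, finite_set [set x | a i x != 0]) ->
  exists r : seq T, [/\ uniq r, forall x, x \in r -> D x &
    forall (V : nmodType) (F : T -> V) i, (forall x, a i x = 0 -> F x = 0) ->
      \sum_(x \in D) F x = \sum_(x <- r) F x].
Proof.
move=> afin; have /choice[s sE] : forall i, exists s : seq T, [set x | a i x != 0] = [set` s].
  by move=> i; exact/finite_seqP.
exists [seq x <- undup (flatten [seq s i | i <- enum I]) | x \in D]; split.
- by rewrite filter_uniq ?undup_uniq.
- by move=> x; rewrite mem_filter => /andP[/set_mem].
move=> V F i F0; rewrite (fsbigE [seq x <- undup (flatten [seq s i | i <- enum I]) | x \in D]).
- rewrite big_seq_cond [RHS]big_seq; apply: eq_bigl => x.
  by rewrite mem_filter; case: (x \in D); rewrite ?andbF ?andbT.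
- by rewrite filter_uniq ?undup_uniq.
- by move=> x /=; rewrite mem_filter => /andP[/set_mem].
move=> x Dx; rewrite mem_filter mem_undup mem_set //= => xs; apply: F0.
apply: contraNeq xs => ax; apply/flattenP; exists (s i); first by rewrite map_f ?mem_enum.
by have : [set` s i] x by rewrite -sE.
Qed.

Lemma multi_power_delta (T : Type) (k : nat) (B : 'I_k -> T -> T) i :
  multi_power B (fun l => (l == i) : nat) = B i.
Proof.
rewrite /multi_power.
suff H (r : seq 'I_k) : uniq r -> \big[(fun f g => f \o g)/id]_(l <- r) iter (l == i) (B l) =
    if i \in r then B i else id.
  by rewrite H ?index_enum_uniq ?mem_index_enum.
elim: r => [|l r IH] /=; first by rewrite big_nil.
move=> /andP[lr ur]; rewrite big_cons IH // inE eq_sym.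
by have [->|_] := eqVneq i l; first by rewrite (negPf lr).
Qed.

(** * From a dilation to positivity *)

Section Adjoint.
Context {R : realType} {H : hilbertType R}.

(** If no vector represented x |-> <U x, y>, then [adj U y] would be the default 0, and U (adj U y)
    = y would give y = 0; but for y = 0 the vector 0 does represent it. *)
Lemma unitary_adj (U : {linear H -> H}) x y : unitary_op U ->
  inner (U x) y = inner x (adj U y).
Proof.
move=> [_ _ UV]; have [[w wP]|nw] := pselect (exists w, forall x, inner (U x) y = inner x w).
  by rewrite (adjE wP).
have y0 : y = 0.
  have := UV y; rewrite /= /adj xgetPN ?linear0 // => w wP.
  by apply: nw; exists w.
by exfalso; apply: nw; exists 0 => z; rewrite y0 !inner0r.
Qed.

Lemma unitary_inner (U : {linear H -> H}) x y : unitary_op U ->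
  inner (U x) (U y) = inner x y.
Proof. by move=> Uu; rewrite unitary_adj //; have [_ /(_ y) /= -> _] := Uu. Qed.

Variables (k : nat) (A : 'I_k -> {linear H -> H}).
Hypothesis Aadj : forall i x y, inner (A i x) y = inner x (adj (A i) y).
Hypothesis AC : commuting A.

Lemma adj_commuting i j x : adj (A i) (adj (A j) x) = adj (A j) (adj (A i) x).
Proof.
apply: inner_eq => z; rewrite innerC [RHS]innerC -!Aadj.
by have /= -> := AC j i z.
Qed.

Lemma inner_bracket_power_Zminus al f g : Zminus al ->
  inner (bracket_power A al f) g =
  (inner (multi_power (fun i => A i) (fun l => `|al l|%N) g) f)^*.
Proof.
move=> alm; rewrite innerC; congr (_^*); rewrite /bracket_power.
(* Within [Zminus] the branch for [Zplus] is taken only at al = 0, where both sides reduce to the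
   identity. *)
case: asboolP => [alp|_]; last first.
  by rewrite (multi_power_adj _ _ _ adj_commuting Aadj).
have -> : abs_power (fun i => A i) al = id.
  rewrite -[RHS](multi_power0 (fun i => A i)); apply: eq_multi_power => l.
  by have := alp l; have := alm l; lia.
rewrite (@eq_multi_power _ _ _ _ (fun=> 0%N)) ?multi_power0 // => l.
by have := alp l; have := alm l; lia.
Qed.

End Adjoint.

Section Dilation.
Context {R : realType} {H K : hilbertType R} {k : nat}.
Variables (A : 'I_k -> {linear H -> H}) (J : {linear H -> K}).
Variables (U : 'I_k -> {linear K -> K}) (P : K -> K).
Hypothesis Jiso : forall x, `|J x| = `|x|.
Hypothesis Uunit : forall i, unitary_op (U i).
Hypothesis UC : commuting U.
Hypothesis PJ : orthogonal_projection (range J) P.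
Hypothesis dil : forall al, Zplus al -> forall x,
  J (bracket_power A al x) = P (bracket_power U al (J x)).

Lemma dilation_projection y z : inner (P y) (J z) = inner y (J z).
Proof.
have [_ /(_ (J z)) h] := PJ y; apply/eqP; rewrite eq_sym -subr_eq0 -innerBl h //; exists z.
Qed.

Lemma dilation_power (b : 'I_k -> nat) f g :
  inner (multi_power (fun i => A i) b f) g =
  inner (multi_power (fun i => U i) b (J f)) (J g).
Proof.
pose al := [ffun l => (b l)%:Z].
have alp : Zplus al by move=> l; rewrite ffunE.
have bE (T : Type) (B : 'I_k -> T -> T) : abs_power B al = multi_power B b.
  by apply: eq_multi_power => l; rewrite ffunE absz_nat.
have := dil alp f; rewrite /bracket_power asboolT // !bE => JE.
by rewrite -(isometry_inner Jiso) JE dilation_projection.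
Qed.

(** The adjoint of [A i] is the compression of that of [U i]: the vector [w] with J w = P (adj (U i)
    (J y)) satisfies its defining equation, so [adj] does not fall back on its default. *)
Lemma dilation_adj i x y : inner (A i x) y = inner x (adj (A i) y).
Proof.
have AU z z' : inner (A i z) z' = inner (U i (J z)) (J z').
  by have := dilation_power (fun l => (l == i) : nat) z z'; rewrite !multi_power_delta.
have [[w _ wP] _] := PJ (adj (U i) (J y)).
suff wE z : inner (A i z) y = inner z w by rewrite (adjE wE).
by rewrite AU unitary_adj // innerC -dilation_projection -wP -innerC isometry_inner.
Qed.

Hypothesis AC : commuting A.

Lemma dilation_bracket_power al f g : (Zplus `|` Zminus) al ->
  inner (bracket_power A al f) g = two_sided (fun i => U i) al (J f) (J g).
Proof.
move=> [alp|alm].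
  rewrite /bracket_power asboolT // [abs_power _ _]/(multi_power _ _) dilation_power.
  have hp : (fun l => int_pos (al l)) =1 (fun l => `|al l|%N).
    by move=> l; have := alp l; case: (al l).
  have hn : (fun l => int_neg (al l)) =1 (fun=> 0%N).
    by move=> l; have := alp l; case: (al l).
  by rewrite /two_sided (eq_multi_power _ hp) (eq_multi_power _ hn) multi_power0.
rewrite (inner_bracket_power_Zminus dilation_adj AC) // dilation_power -innerC.
have hp : (fun l => int_pos (al l)) =1 (fun=> 0%N).
  by move=> l; have := alm l; case: (al l) => //; case.
have hn : (fun l => int_neg (al l)) =1 (fun l => `|al l|%N).
  by move=> l; have := alm l; case: (al l) => //; case.
by rewrite /two_sided (eq_multi_power _ hp) (eq_multi_power _ hn) multi_power0.
Qed.

Lemma dilation_positivity m (a : 'I_m -> 'I_m -> {ffun 'I_k -> int} -> R[i]) :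
  (forall i j, finite_system (a i j)) ->
  (forall (lam : 'I_k -> R[i]) (z : 'I_m -> R[i]), torus lam ->
     0 <= \sum_(i < m) \sum_(j < m) \sum_(al \in Zplus `|` Zminus)
            (a i j al * monomial lam al * z i * (z j)^*)) ->
  forall f : 'I_m -> H,
    0 <= \sum_(i < m) \sum_(j < m) \sum_(al \in Zplus `|` Zminus)
           (a i j al * inner (bracket_power A al (f i)) (f j)).
Proof.
move=> afin apos f.
have [r [_ rD rE]] := common_support (Zplus `|` Zminus)
  (fun ij : 'I_m * 'I_m => afin ij.1 ij.2).
have := @fejer_positivity R K k (fun i => U i) (fun i j x => UC i j x)
  (fun i x y => unitary_inner x y (Uunit i)) m r a _ (fun i => J (f i)).
rewrite (_ : \sum_(i < m) _ = \sum_(i < m) \sum_(j < m) \sum_(al \in Zplus `|` Zminus)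
           (a i j al * inner (bracket_power A al (f i)) (f j))); last first.
  apply: eq_bigr => i _; apply: eq_bigr => j _.
  rewrite (rE _ _ (i, j)) => [|al /= ->]; last by rewrite mul0r.
  by apply: eq_big_seq => al /rD alD; rewrite dilation_bracket_power.
apply => lam z lamT; have := apos lam z lamT; congr (0 <= _).
apply: eq_bigr => i _; apply: eq_bigr => j _.
rewrite (rE _ _ (i, j)) => [|al /= ->]; last by rewrite !mul0r.
by rewrite !mulr_suml.
Qed.

End Dilation.

(** * Trigonometric polynomials and determining sets *)

Section Collect.
Context {T : choiceType} {C : comPzRingType}.
Implicit Types (s : seq (T * C)).

(** Lists of terms, in which a frequency may repeat, are easy to build and to multiply; this turns
    them into coefficient systems. *)
Definition collect s (x : T) : C := \sum_(p <- s | p.1 == x) p.2.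

Lemma collect_notin s x : x \notin [seq p.1 | p <- s] -> collect s x = 0.
Proof.
move=> xs; apply: big1_seq => p /andP[/eqP px ps].
by exfalso; move/negP: xs; apply; rewrite -px map_f.
Qed.

Lemma collect_finite s : finite_set [set x | collect s x != 0].
Proof.
apply: (@sub_finite_set _ _ [set` [seq p.1 | p <- s]]); last first.
  by apply/finite_seqP; exists [seq p.1 | p <- s].
by move=> x /= ; apply: contraR => /collect_notin ->.
Qed.

Lemma sum_collect (D : set T) s (F : T -> C) : (forall p, p \in s -> D p.1) ->
  \sum_(x \in D) collect s x * F x = \sum_(p <- s) p.2 * F p.1.
Proof.
move=> sD; rewrite (fsbigE (undup [seq p.1 | p <- s])) ?undup_uniq //; last 2 first.
- by move=> x /=; rewrite mem_undup => /mapP[p ps ->]; exact: sD.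
- by move=> x _; rewrite mem_undup => /collect_notin ->; rewrite mul0r.
rewrite big_seq_cond (eq_bigl (fun x => x \in undup [seq p.1 | p <- s])); last first.
  move=> x; apply/andP/idP => [[]//|xs]; split=> //; apply/mem_set.
  by move: xs; rewrite mem_undup => /mapP[p ps ->]; exact: sD.
rewrite -big_seq; under eq_bigr do rewrite mulr_suml big_mkcond.
rewrite exchange_big /=; apply: eq_big_seq => p ps.
rewrite (bigD1_seq p.1) ?undup_uniq ?mem_undup ?map_f //= eqxx big1 ?addr0 // => x xp.
by rewrite eq_sym (negPf xp).
Qed.

End Collect.

Section TrigPoly.
Context {R : realType} {k : nat}.
Implicit Types (lam : 'I_k -> R[i]) (al be : {ffun 'I_k -> int}) (p q : ('I_k -> R[i]) -> R[i]).

Lemma torus_unit lam l : torus lam -> lam l \is a GRing.unit.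
Proof. by move=> lamT; rewrite unitfE -normr_eq0 lamT oner_eq0. Qed.

Lemma monomial0 lam : monomial lam 0 = 1.
Proof. by apply: big1 => l _; rewrite ffunE expr0z. Qed.

Lemma monomialD lam al be : torus lam ->
  monomial lam (al + be) = monomial lam al * monomial lam be.
Proof.
move=> lamT; rewrite /monomial -big_split; apply: eq_bigr => l _.
by rewrite ffunE exprzDr ?torus_unit.
Qed.

Lemma monomial_conj lam al : torus lam -> (monomial lam al)^* = monomial lam (- al).
Proof.
move=> lamT; rewrite rmorph_prod; apply: eq_bigr => l _ /=.
by rewrite ffunE -exprz_inv -unimodular_conj // rmorphXz // torus_unit.
Qed.

Lemma monomialK lam al : torus lam -> monomial lam (- al) * monomial lam al = 1.
Proof. by move=> lamT; rewrite -monomialD // addNr monomial0. Qed.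

Lemma monomial_neq0 lam al : torus lam -> monomial lam al != 0.
Proof.
move=> lamT; apply: contra_eqN (monomialK al lamT) => /eqP ->.
by rewrite mulr0 eq_sym oner_neq0.
Qed.

Definition trig_eval (s : seq ({ffun 'I_k -> int} * R[i])) lam : R[i] :=
  \sum_(p <- s) p.2 * monomial lam p.1.

Definition trig_poly p := exists s, forall lam, torus lam -> p lam = trig_eval s lam.

Lemma trig_polyD p q : trig_poly p -> trig_poly q -> trig_poly (fun lam => p lam + q lam).
Proof.
move=> [s sp] [t tq]; exists (s ++ t) => lam lamT.
by rewrite /trig_eval big_cat sp ?tq.
Qed.

Lemma trig_polyM p q : trig_poly p -> trig_poly q -> trig_poly (fun lam => p lam * q lam).
Proof.
move=> [s sp] [t tq]; exists [seq (x.1 + y.1, x.2 * y.2) | x <- s, y <- t] => lam lamT.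
rewrite sp // tq // /trig_eval big_allpairs_dep mulr_suml; apply: eq_bigr => x _.
rewrite mulr_sumr; apply: eq_bigr => y _.
by rewrite monomialD //= mulrACA.
Qed.

Lemma trig_poly_conj p : trig_poly p -> trig_poly (fun lam => (p lam)^*).
Proof.
move=> [s sp]; exists [seq (- x.1, x.2^*) | x <- s] => lam lamT.
rewrite sp // /trig_eval big_map rmorph_sum; apply: eq_bigr => x _ /=.
by rewrite rmorphM /= monomial_conj.
Qed.

Lemma trig_polyN p : trig_poly p -> trig_poly (fun lam => - p lam).
Proof.
move=> [s sp]; exists [seq (x.1, - x.2) | x <- s] => lam lamT.
by rewrite sp // /trig_eval big_map -sumrN; apply: eq_bigr => x _; rewrite mulNr.
Qed.

Lemma trig_poly_sum (I : Type) (r : seq I) (P : I -> ('I_k -> R[i]) -> R[i]) :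
  (forall i, trig_poly (P i)) -> trig_poly (fun lam => \sum_(i <- r) P i lam).
Proof.
move=> Pt; elim: r => [|i r IH].
  by exists [::] => lam _; rewrite /trig_eval !big_nil.
have [s sP] := trig_polyD (Pt i) IH; exists s => lam lamT.
by rewrite big_cons sP.
Qed.

Lemma trig_poly_fsum (D : set {ffun 'I_k -> int}) a : finite_system a ->
  trig_poly (fun lam => \sum_(al \in D) a al * monomial lam al).
Proof.
move=> afin; have [r [_ _ rE]] := common_support D (fun _ : unit => afin).
exists [seq (al, a al) | al <- r] => lam _; rewrite /trig_eval big_map.
by apply: (rE _ _ tt) => al ->; rewrite mul0r.
Qed.

Lemma trig_poly_analytic p : analytic_trig_poly p -> trig_poly p.
Proof.
move=> [a afin pE]; have [s sE] := trig_poly_fsum Zplus afin.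
by exists s => lam lamT; rewrite pE // sE.
Qed.

Lemma analytic_trig_eval (s : seq ({ffun 'I_k -> int} * R[i])) :
  (forall x, x \in s -> Zplus x.1) ->
  analytic_trig_poly (trig_eval s).
Proof.
move=> sp; exists (collect s); first exact: collect_finite.
by move=> lam _; rewrite sum_collect.
Qed.

(* A single monomial shifts a given finite set of frequencies into [Zplus]. *)
Lemma Zplus_shift (s : seq {ffun 'I_k -> int}) :
  exists be : {ffun 'I_k -> int}, forall al, al \in s -> Zplus (be + al).
Proof.
exists [ffun l => (\sum_(al <- s) `|al l|%N)%:Z] => al als l.
rewrite !ffunE (big_rem al) //=; lia.
Qed.

Lemma determining_trig_poly (Y : set ('I_k -> R[i])) p : determining Y -> trig_poly p ->
  (forall lam, Y lam -> p lam = 0) -> forall lam, torus lam -> p lam = 0.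
Proof.
move=> [_ YT Ydet] [s sp] pY lam lamT.
have [be beP] := Zplus_shift [seq x.1 | x <- s].
pose t := [seq (be + x.1, x.2) | x <- s].
have tE mu : torus mu -> trig_eval t mu = monomial mu be * p mu.
  move=> muT; rewrite sp // /trig_eval big_map mulr_sumr; apply: eq_bigr => x _ /=.
  by rewrite monomialD // mulrCA.
have /Ydet h : analytic_trig_poly (trig_eval t).
  by apply: analytic_trig_eval => _ /mapP[x xs ->]; apply/beP/map_f.
apply: (mulfI (monomial_neq0 be lamT)); rewrite mulr0 -tE //.
by apply: h => // mu muY; rewrite tE ?pY ?mulr0 //; exact: YT.
Qed.

Lemma determining_positivity (Y : set ('I_k -> R[i])) m n
    (a : 'I_m -> 'I_m -> {ffun 'I_k -> int} -> R[i])
    (q : 'I_m -> 'I_n -> ('I_k -> R[i]) -> R[i]) :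
  determining Y -> (forall i j, finite_system (a i j)) ->
  (forall i l, analytic_trig_poly (q i l)) ->
  (forall lam, Y lam -> forall i j,
     \sum_(al \in Zplus `|` Zminus) (a i j al * monomial lam al) =
     \sum_(l < n) q i l lam * (q j l lam)^*) ->
  forall (lam : 'I_k -> R[i]) (z : 'I_m -> R[i]), torus lam ->
    0 <= \sum_(i < m) \sum_(j < m) \sum_(al \in Zplus `|` Zminus)
           (a i j al * monomial lam al * z i * (z j)^*).
Proof.
move=> Ydet afin qan Yeq lam z lamT.
have eqT i j : \sum_(al \in Zplus `|` Zminus) (a i j al * monomial lam al) =
    \sum_(l < n) q i l lam * (q j l lam)^*.
  apply/eqP; rewrite -subr_eq0; apply/eqP.
  apply: (determining_trig_poly (p := fun mu =>
    \sum_(al \in Zplus `|` Zminus) (a i j al * monomial mu al) -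
    \sum_(l < n) q i l mu * (q j l mu)^*) Ydet) => // [|mu /Yeq ->]; last by rewrite subrr.
  apply: trig_polyD; first exact: trig_poly_fsum.
  apply: trig_polyN; apply: trig_poly_sum => l; apply: trig_polyM.
    exact: trig_poly_analytic.
  exact/trig_poly_conj/trig_poly_analytic.
(* With the factorization valid on the whole torus, the quadratic form is a sum of squares. *)
rewrite (_ : \sum_(i < m) _ = \sum_(l < n) `|\sum_(i < m) q i l lam * z i| ^+ 2).
  by apply: sumr_ge0 => l _; rewrite exprn_ge0.
under [RHS]eq_bigr do rewrite normCK mulr_suml.
rewrite [RHS]exchange_big; apply: eq_bigr => i _.
under [RHS]eq_bigr do rewrite rmorph_sum mulr_sumr.
rewrite [RHS]exchange_big; apply: eq_bigr => j _ /=.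
have [r [_ rD rE]] := common_support (Zplus `|` Zminus)
  (fun ij : 'I_m * 'I_m => afin ij.1 ij.2).
rewrite (rE _ _ (i, j)) => [|al /= ->]; last by rewrite !mul0r.
rewrite -!mulr_suml; have := eqT i j.
rewrite (rE _ _ (i, j)) => [->|al /= ->]; last by rewrite !mul0r.
by rewrite !mulr_suml; apply: eq_bigr => l _; rewrite rmorphM /=; ring.
Qed.

End TrigPoly.

(** * From positivity to a dilation *)

(** The factors are composed in increasing order of the indices, which is where i < j enters. This
    fixed order will yield the commutation of the [A i]. *)
Lemma multi_power_delta2 (T : Type) (k : nat) (B : 'I_k -> T -> T) (i j : 'I_k) : (i < j)%N ->
  multi_power B (fun l => (l == i) + (l == j))%N = B i \o B j.
Proof.
move=> ij; rewrite /multi_power.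
suff H (r : seq 'I_k) : sorted (fun l l' : 'I_k => (l < l')%N) r ->
    \big[(fun f g => f \o g)/id]_(l <- r) iter ((l == i) + (l == j)) (B l) =
    (if i \in r then B i else id) \o (if j \in r then B j else id).
  have := H (enum 'I_k); rewrite !mem_enum !inE => <-.
    by rewrite [index_enum _]unlock -enumT.
  by have := iota_ltn_sorted 0 k; rewrite -val_enum_ord sorted_map.
elim: r => [|l r IH] rs; first by rewrite big_nil.
have lr l' : l' \in r -> (l < l')%N.
  by move=> l'r; have := order_path_min (leT := fun l l' : 'I_k => (l < l')%N)
    (fun y x z => @ltn_trans y x z) rs => /allP /(_ _ l'r).
rewrite big_cons IH ?(path_sorted rs) // !inE.
have nin (l' : 'I_k) : (l' <= l)%N -> (l' \in r) = false.
  by move=> l'l; apply/negP => /lr; rewrite ltnNge l'l.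
have [li|li] := eqVneq l i.
  have lj : (l == j) = false by rewrite li -val_eqE /= ltn_eqF.
  by rewrite -li nin // [j == l]eq_sym lj.
rewrite [j == l]eq_sym; have [lj|lj] := eqVneq l j; first by rewrite -lj !nin // lj ltnW.
by [].
Qed.

Lemma multi_power_linear (R : pzRingType) (V : lmodType R) (k : nat)
    (A : 'I_k -> {linear V -> V}) b :
  linear (multi_power (fun i => A i) b).
Proof.
move=> a x y; rewrite /multi_power; elim/big_rec: _ => //= i g _ ->.
by elim: (b i) => //= n ->; rewrite linearP.
Qed.

Lemma bracket_power0 (R : realType) (H : hilbertType R) k (A : 'I_k -> {linear H -> H}) :
  bracket_power A 0 = id.
Proof.
have h (B : 'I_k -> H -> H) : abs_power B (0 : {ffun 'I_k -> int}) = id.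
  by rewrite -(multi_power0 B); apply: eq_multi_power => l; rewrite ffunE.
by rewrite /bracket_power !h; case: asboolP.
Qed.

(** * Vector-valued trigonometric polynomials *)

Section VectorTrigPoly.
Context {R : realType} {H : hilbertType R} {k : nat}.
Implicit Types (lam : 'I_k -> R[i]) (x y : H).

(* The polynomials [lam |-> \sum_b lam^b f_b] with values in [H], and their
   operator-valued analogues [lam |-> \sum_p lam^p f_p (x) g_p^*], are encoded
   by lists of terms and evaluated against vectors. *)
Definition vec_eval (t : seq ({ffun 'I_k -> int} * H)) lam x : R[i] :=
  \sum_(b <- t) monomial lam b.1 * inner b.2 x.

Definition form_eval (s : seq ({ffun 'I_k -> int} * (H * H))) lam x y : R[i] :=
  \sum_(p <- s) monomial lam p.1 * inner p.2.1 x * inner y p.2.2.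

Lemma vec_evalP t lam a x y :
  vec_eval t lam (a *: x + y) = a^* * vec_eval t lam x + vec_eval t lam y.
Proof.
rewrite /vec_eval mulr_sumr -big_split; apply: eq_bigr => b _ /=.
by rewrite innerDr innerZr; ring.
Qed.

Lemma form_evalPr s lam a x y z :
  form_eval s lam z (a *: x + y) = a * form_eval s lam z x + form_eval s lam z y.
Proof.
rewrite /form_eval mulr_sumr -big_split; apply: eq_bigr => p _ /=.
by rewrite innerDl innerZl; ring.
Qed.

Lemma form_evalPl s lam a x y z :
  form_eval s lam (a *: x + y) z = a^* * form_eval s lam x z + form_eval s lam y z.
Proof.
rewrite /form_eval mulr_sumr -big_split; apply: eq_bigr => p _ /=.
by rewrite innerDr innerZr; ring.
Qed.

End VectorTrigPoly.

(** A zero diagonal makes [D] antisymmetric. At ['i *: y] the two arguments scale by conjugate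
    factors, so antisymmetry there says that twice [D x y] is 0. *)
Lemma sesquilinear_eq0 (C : numClosedFieldType) (V : lmodType C) (D : V -> V -> C) :
  (forall a x x' y, D (a *: x + x') y = a^* * D x y + D x' y) ->
  (forall a x y y', D x (a *: y + y') = a * D x y + D x y') ->
  (forall x, D x x = 0) -> forall x y, D x y = 0.
Proof.
move=> Dl Dr D0 x y.
have anti u v : D u v = - D v u.
  have := D0 (1 *: u + v); rewrite Dl !Dr !D0 conjC1 !mul1r addr0 add0r.
  by move=> /eqP; rewrite addr_eq0 => /eqP.
have Z0 u v a : D u (a *: v) = a * D u v.
  have := Dr a u v 0; rewrite addr0 => ->; have := Dr 1 u 0 0.
  rewrite scale1r addr0 mul1r => /eqP.
  by rewrite addrC eq_sym -subr_eq0 addrK => /eqP ->; rewrite addr0.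
have Zl u v a : D (a *: u) v = a^* * D u v.
  have := Dl a u 0 v; rewrite addr0 => ->.
  have D00 : D v 0 = 0 by rewrite -[X in D v X](scale0r (0 : V)) Z0 mul0r.
  by rewrite [D 0 v]anti D00 oppr0 addr0.
have := anti ('i *: y) x; rewrite Zl Z0 conjCi [D y x]anti mulrNN => /eqP.
by rewrite -addr_eq0 -mulr2n mulrn_eq0 /= mulf_eq0 (negPf (neq0Ci _)) => /eqP.
Qed.

Section VectorTrigSpace.
Context {R : realType} {H : hilbertType R} {k : nat}.

(** A polynomial h with values in [H] is identified with the scalar function (lam, x) |-> <h(lam),
    x>, so that equality on the torus becomes equality of functions and different lists of terms may
    give the same element. *)
Definition torus_vectors : Type := ({lam : 'I_k -> R[i] | torus lam} * H)%type.

Implicit Types (w : torus_vectors).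

Lemma torus_vectorsP w : torus (sval w.1).
Proof. by case: w => -[]. Qed.

Definition vec_fun t w : R[i] := vec_eval t (sval w.1) w.2.

Definition form_fun s w : R[i] := form_eval s (sval w.1) w.2 w.2.

Definition scale_terms (T : Type) (a : R[i]) (s : seq (T * (H * H))) :=
  [seq (p.1, (a *: p.2.1, p.2.2)) | p <- s].

Lemma form_funZ a s : form_fun (scale_terms a s) = a *: form_fun s.
Proof.
apply/funext => w; rewrite scalrfctE /form_fun /form_eval big_map scaler_sumr.
by apply: eq_bigr => p _; rewrite /= innerZl /GRing.scale /=; ring.
Qed.

Lemma form_funD s s' : form_fun (s ++ s') = form_fun s + form_fun s'.
Proof. by apply/funext => w; rewrite /form_fun /form_eval big_cat. Qed.

Lemma vec_fun_mul_conj t t' :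
  (fun w => vec_fun t w * (vec_fun t' w)^*) =
  form_fun [seq (b.1 - b'.1, (b.2, b'.2)) | b <- t, b' <- t'].
Proof.
apply/funext => w; have wT := torus_vectorsP w.
rewrite /form_fun /form_eval big_allpairs_dep /vec_fun mulr_suml; apply: eq_bigr => b _.
rewrite rmorph_sum mulr_sumr; apply: eq_bigr => b' _ /=.
by rewrite rmorphM /= monomialD // monomial_conj // -innerC; ring.
Qed.

Definition vec_trig_pred : {pred torus_vectors -> R[i]} :=
  fun h => `[< exists t, h = vec_fun t >].

Lemma vec_trig_pred_submod : submod_closed vec_trig_pred.
Proof.
split=> [|a _ _ /asboolP[t ->] /asboolP[t' ->]]; apply/asboolP.
  by exists [::]; apply/funext => w; rewrite /vec_fun /vec_eval big_nil.
exists ([seq (b.1, a *: b.2) | b <- t] ++ t'); apply/funext => w.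
rewrite /vec_fun /vec_eval big_cat big_map; congr (_ + _).
rewrite scalrfctE scaler_sumr; apply: eq_bigr => b _ /=.
by rewrite innerZl mulrCA.
Qed.

HB.instance Definition _ := GRing.isSubmodClosed.Build _ _ vec_trig_pred
  vec_trig_pred_submod.

Record vec_trig := VecTrig {
  vec_trig_val :> torus_vectors -> R[i];
  _ : vec_trig_val \in vec_trig_pred
}.

HB.instance Definition _ := [isSub for vec_trig_val].

HB.instance Definition _ := [Choice of vec_trig by <:].

HB.instance Definition _ := [SubChoice_isSubLmodule of vec_trig by <:].

Lemma vec_trigP (h : vec_trig) : exists t, vec_trig_val h = vec_fun t.
Proof. exact/asboolP/(valP h). Qed.

Lemma vec_trig_ext (h h' : vec_trig) : (forall w, h w = h' w) -> h = h'.
Proof. by move=> hh; apply/val_inj/funext. Qed.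

Lemma mul_monomial_proof (be : {ffun 'I_k -> int}) (h : vec_trig) :
  (fun w => monomial (sval w.1) be * h w) \in vec_trig_pred.
Proof.
apply/asboolP; have [t ->] := vec_trigP h.
exists [seq (be + b.1, b.2) | b <- t]; apply/funext => w.
rewrite /vec_fun /vec_eval big_map mulr_sumr; apply: eq_bigr => b _ /=.
by rewrite monomialD ?mulrA //; exact: torus_vectorsP.
Qed.

Definition mul_monomial be (h : vec_trig) : vec_trig := VecTrig (mul_monomial_proof be h).

Lemma mul_monomial_linear be : linear (mul_monomial be).
Proof.
move=> a h h'; apply: vec_trig_ext => w /=.
by rewrite mulrDr; congr (_ + _); rewrite [LHS]mulrCA.
Qed.

HB.instance Definition _ be :=
  GRing.isLinear.Build _ _ _ _ (mul_monomial be) (mul_monomial_linear be).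

Lemma mul_monomialD be be' h : mul_monomial (be + be') h = mul_monomial be (mul_monomial be' h).
Proof.
by apply: vec_trig_ext => w /=; rewrite monomialD ?mulrA //; exact: torus_vectorsP.
Qed.

Lemma mul_monomial0 h : mul_monomial 0 h = h.
Proof. by apply: vec_trig_ext => w /=; rewrite monomial0 mul1r. Qed.

Lemma const_trig_proof (f : H) : (fun w : torus_vectors => inner f w.2) \in vec_trig_pred.
Proof.
apply/asboolP; exists [:: (0, f)]; apply/funext => w.
by rewrite /vec_fun /vec_eval big_seq1 monomial0 mul1r.
Qed.

Definition const_trig f := VecTrig (const_trig_proof f).

Lemma const_trig_linear : linear const_trig.
Proof. by move=> a f g; apply: vec_trig_ext => w /=; rewrite innerDl innerZl. Qed.

HB.instance Definition _ := GRing.isLinear.Build _ _ _ _ const_trig const_trig_linear.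

End VectorTrigSpace.

(** * Consequences of condition (iii) *)

Section CompletePositivity.
Context {R : realType} {H : hilbertType R} {k : nat}.
Variables (A : 'I_k -> {linear H -> H}) (Y : set ('I_k -> R[i])).
Hypothesis YT : Y `<=` @torus R k.
Hypothesis Apos : forall (m : nat) (a : 'I_m -> 'I_m -> {ffun 'I_k -> int} -> R[i]),
  (0 < m)%N -> (forall i j, finite_system (a i j)) ->
  (exists (n : nat) (q : 'I_m -> 'I_n -> ('I_k -> R[i]) -> R[i]),
     [/\ (0 < n)%N,
         forall i l, analytic_trig_poly (q i l) &
         forall lam, Y lam -> forall i j,
           \sum_(al \in Zplus `|` Zminus) (a i j al * monomial lam al) =
           \sum_(l < n) q i l lam * (q j l lam)^*]) ->
  forall f : 'I_m -> H,
    0 <= \sum_(i < m) \sum_(j < m) \sum_(al \in Zplus `|` Zminus)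
           (a i j al * inner (bracket_power A al (f i)) (f j)).

Lemma bracket_power_pair (al : {ffun 'I_k -> int}) (c : R[i]) (f g : H) : Zplus al ->
  0 <= c * inner (bracket_power A al f) g + c^* * inner (bracket_power A (- al) g) f +
       (`|c| ^+ 2 * inner f f + inner g g).
Proof.
move=> alp; have alm : Zminus (- al) by move=> l; rewrite ffunE oppr_le0.
have zp : @Zplus k 0 by move=> l; rewrite ffunE.
(* The entries q_i conj(q_j) of the rank one matrix for q = (c lam^al, 1). *)
pose t (i j : 'I_2) : seq ({ffun 'I_k -> int} * R[i]) :=
  if i == 0 then (if j == 0 then [:: (0, `|c| ^+ 2)] else [:: (al, c)])
  else (if j == 0 then [:: (- al, c^*)] else [:: (0, 1)]).
have tD i j p : p \in t i j -> (Zplus `|` Zminus) p.1.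
  by rewrite /t; do 2 case: ifP => _; rewrite inE => /eqP ->; [left|left|right|left].
pose q (i : 'I_2) : seq ({ffun 'I_k -> int} * R[i]) :=
  if i == 0 then [:: (al, c)] else [:: (0, 1)].
have := @Apos 2 (fun i j => collect (t i j)) isT (fun i j => collect_finite _) _
  (fun i : 'I_2 => if i == 0 then f else g).
have -> : forall (B : 'I_2 -> 'I_2 -> R[i]), \sum_(i < 2) \sum_(j < 2) B i j =
    B 0 1 + B 1 0 + (B 0 0 + B 1 1).
  by move=> B; rewrite !big_ord_recl !big_ord0 !addr0 (_ : lift _ _ = 1); [ring|exact/val_inj].
rewrite !sum_collect; try exact: tD.
rewrite /t /= !big_seq1 /= bracket_power0 mul1r; apply.
exists 1%N, (fun i _ => trig_eval (q i)); split=> // [i _|lam /YT lamT i j].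
  by apply: analytic_trig_eval => p; rewrite /q; case: ifP => _; rewrite inE => /eqP ->.
rewrite sum_collect; last exact: tD.
rewrite big_ord1 /trig_eval /t /q.
by do 2 case: ifP => _; rewrite !big_seq1 /= rmorphM /= monomial_conj // ?conjC1
  ?oppr0 ?monomial0 ?mul1r ?mulr1 // mulrACA -?normCK
  [monomial lam al * _]mulrC monomialK ?mulr1.
Qed.

(** The nonnegative expression of [bracket_power_pair] is real for every [c]; the choices 1 and ['i]
    separate the two parts of the identity. *)
Lemma bracket_power_conj al (f g : H) : Zplus al ->
  inner (bracket_power A al f) g = (inner (bracket_power A (- al) g) f)^*.
Proof.
move=> alp; set x := inner _ g; set y := inner _ f.
have re c : c * x + c^* * y = c^* * x^* + c * y^*.
  have /ger0_real := bracket_power_pair c f g alp.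
  have /ger0_real nr : 0 <= `|c| ^+ 2 * inner f f + inner g g.
    by rewrite addr_ge0 ?mulr_ge0 ?exprn_ge0.
  rewrite rpredDr // => /CrealP; rewrite rmorphD !rmorphM /= conjCK => <-.
  by rewrite addrC.
have := re 1; have := re 'i; rewrite conjC1 conjCi !mul1r !mulNr => h1 h2.
have h3 : x - y = y^* - x^*.
  apply: (mulfI (neq0Ci R[i])); rewrite !mulrBr h1 addrC.
  by [].
have : x *+ 2 = y^* *+ 2.
  have -> : x *+ 2 = (x + y) + (x - y) by ring.
  by rewrite h2 h3; ring.
by move=> /eqP; rewrite eqrMn2r // => /orP[//|/eqP].
Qed.

Lemma complete_positivity_adj i x y : inner (A i x) y = inner x (adj (A i) y).
Proof.
pose al : {ffun 'I_k -> int} := [ffun l => ((l == i) : nat)%:Z].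
have alp : Zplus al by move=> l; rewrite ffunE.
have := bracket_power_conj x y alp; rewrite -innerC /bracket_power asboolT //.
rewrite asboolF; last by move=> /(_ i); rewrite !ffunE eqxx.
rewrite /abs_power -!/(multi_power _ _).
rewrite !(@eq_multi_power _ _ _ _ (fun l => (l == i) : nat)) ?multi_power_delta //.
  by move=> l; rewrite !ffunE abszN.
by move=> l; rewrite !ffunE.
Qed.

(** For i < j both bracket powers at the sum of two unit multi-indices list the factors in the same
    order, so <A_i A_j x, y> = <x, adj(A_i) adj(A_j) y>. Moving the adjoints back one by one gives
    <A_j A_i x, y>. *)
Lemma complete_positivity_commuting : commuting A.
Proof.
have C (i j : 'I_k) x : (i < j)%N -> A i (A j x) = A j (A i x).
  move=> ij; apply: inner_eq => y.
  pose al : {ffun 'I_k -> int} := [ffun l => ((l == i) + (l == j))%N%:Z].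
  have alp : Zplus al by move=> l; rewrite ffunE.
  have := bracket_power_conj x y alp; rewrite -innerC /bracket_power asboolT //.
  rewrite asboolF; last by move=> /(_ i); rewrite !ffunE eqxx.
  rewrite /abs_power -!/(multi_power _ _).
  rewrite !(@eq_multi_power _ _ _ _ (fun l => (l == i) + (l == j))%N) ?multi_power_delta2 //=.
  - by move=> ->; rewrite -!complete_positivity_adj.
  - by move=> l; rewrite !ffunE abszN.
  - by move=> l; rewrite !ffunE.
move=> i j x /=; have [ij|ij|ij] := ltngtP i j; first exact: C.
  exact/esym/C.
by have -> : i = j by exact: val_inj.
Qed.

(** [adj] carries no linear structure, so on [Zminus] linearity is obtained by moving the operators
    to the other argument. *)
Lemma bracket_power_scalar al g : (Zplus `|` Zminus) al ->
  scalar (fun f => inner (bracket_power A al f) g).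
Proof.
move=> alD a x y; case: alD => [alp|alm].
  rewrite /bracket_power asboolT // /abs_power -!/(multi_power _ _).
  by rewrite multi_power_linear innerDl innerZl.
rewrite !(inner_bracket_power_Zminus complete_positivity_adj complete_positivity_commuting) //.
by rewrite innerDr innerZr rmorphD rmorphM /= conjCK.
Qed.

Lemma bracket_power_sum al g (I : Type) (r : seq I) (F : I -> H) : (Zplus `|` Zminus) al ->
  inner (bracket_power A al (\sum_(i <- r) F i)) g =
  \sum_(i <- r) inner (bracket_power A al (F i)) g.
Proof.
move=> alD; have lin := bracket_power_scalar g alD.
elim: r => [|i r IH].
  have := lin (-1) 0 0; rewrite scaler0 addr0 mulN1r addNr big_nil => ->.
  by rewrite big_nil.
by rewrite !big_cons -[F i]scale1r lin mul1r IH scale1r.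
Qed.

Lemma bracket_powerZ al g a f : (Zplus `|` Zminus) al ->
  inner (bracket_power A al (a *: f)) g = a * inner (bracket_power A al f) g.
Proof.
move=> alD; have lin := bracket_power_scalar g alD.
have := bracket_power_sum g ([::] : seq unit) (fun=> 0) alD; rewrite !big_nil => l0.
by rewrite -[a *: f]addr0 lin l0 addr0.
Qed.

(** Evaluating the form at the vectors [e i] of a finite frame gives a matrix system to which (iii)
    applies; the expansions of the vectors of [s] reassemble its conclusion at the vectors [e i]. *)
Lemma form_positivity s (hs : seq (seq ({ffun 'I_k -> int} * H))) :
  (forall p, p \in s -> (Zplus `|` Zminus) p.1) ->
  (forall lam x y, torus lam ->
     form_eval s lam x y = \sum_(h <- hs) vec_eval h lam x * (vec_eval h lam y)^*) ->
  0 <= \sum_(p <- s) inner (bracket_power A p.1 p.2.1) p.2.2.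
Proof.
move=> sD sE.
have [e0 e0P] := finite_frame ([seq p.2.1 | p <- s] ++ [seq p.2.2 | p <- s]).
(* The additional vector 0 makes [m] positive and contributes nothing to the expansions. *)
pose m := (size e0).+1; pose e (i : 'I_m) := nth 0 (0 :: e0) i.
have eP f : f \in [seq p.2.1 | p <- s] ++ [seq p.2.2 | p <- s] ->
    \sum_(i < m) inner f (e i) *: e i = f.
  move=> /e0P {2}<-; rewrite big_ord_recl /e /= inner0r scaler0 add0r.
  by rewrite /frame_expansion (big_nth 0) big_mkord.
pose t i j := [seq (p.1, inner p.2.1 (e i) * inner (e j) p.2.2) | p <- s].
have tD i j p : p \in t i j -> (Zplus `|` Zminus) p.1.
  by move=> /mapP[p' /sD p'D ->].
have tE (F : {ffun 'I_k -> int} -> R[i]) i j :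
    \sum_(al \in Zplus `|` Zminus) collect (t i j) al * F al =
    \sum_(p <- s) inner p.2.1 (e i) * inner (e j) p.2.2 * F p.1.
  by rewrite sum_collect ?big_map //; exact: tD.
have [be beP] := Zplus_shift [seq b.1 | b <- flatten hs].
(* The factor lam^be makes the entries analytic and cancels against its conjugate; the empty
   polynomial in front keeps the number of columns positive. *)
pose q (i : 'I_m) (l : 'I_(size hs).+1) : seq ({ffun 'I_k -> int} * R[i]) :=
  [seq (be + b.1, inner b.2 (e i)) | b <- nth [::] ([::] :: hs) l].
have qE i l lam : torus lam ->
    trig_eval (q i l) lam = monomial lam be * vec_eval (nth [::] ([::] :: hs) l) lam (e i).
  move=> lamT; rewrite /trig_eval big_map mulr_sumr; apply: eq_bigr => b _ /=.
  by rewrite monomialD //; ring.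
have := @Apos m (fun i j => collect (t i j)) isT (fun i j => collect_finite _) _ e.
rewrite (_ : \sum_(i < m) _ = \sum_(p <- s) inner (bracket_power A p.1 p.2.1) p.2.2).
  apply; exists (size hs).+1, (fun i l => trig_eval (q i l)).
  split=> // [i l|lam /YT lamT i j].
    apply: analytic_trig_eval => x /mapP[b bl ->]; apply: beP; apply: map_f.
    move: bl; case: l => -[|l] //= ll bl; apply/flattenP.
    by exists (nth [::] hs l) => //; rewrite mem_nth.
  rewrite tE.
  transitivity (form_eval s lam (e i) (e j)); first by apply: eq_bigr => p _; ring.
  rewrite sE // big_ord_recl !qE // [vec_eval (nth _ _ ord0) _ _]big_nil mulr0 mul0r add0r.
  rewrite (big_nth [::]) big_mkord; apply: eq_bigr => l _; rewrite !qE //= rmorphM /=.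
  by rewrite monomial_conj // mulrACA [monomial _ _ * _]mulrC monomialK // mul1r.
under eq_bigr do under eq_bigr do rewrite tE.
under eq_bigr do rewrite exchange_big.
rewrite exchange_big; apply: eq_big_seq => p ps /=.
have [f1 f2] : p.2.1 \in [seq p.2.1 | p <- s] ++ [seq p.2.2 | p <- s] /\
    p.2.2 \in [seq p.2.1 | p <- s] ++ [seq p.2.2 | p <- s].
  rewrite !mem_cat (map_f (fun p => p.2.1) ps) (map_f (fun p => p.2.2) ps).
  by rewrite orbT.
have pD := sD p ps.
transitivity (inner (bracket_power A p.1
    (\sum_(i < m) inner p.2.1 (e i) *: e i)) p.2.2); last first.
  by rewrite (eP _ f1).
rewrite bracket_power_sum //; apply: eq_bigr => i _.
rewrite bracket_powerZ // -[in RHS](eP _ f2) inner_sumr mulr_sumr.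
by apply: eq_bigr => j _; rewrite innerZr -innerC; ring.
Qed.

(** Adding the adjoint [s'] of [s] doubles the real part on the diagonal, which then agrees with the
    squares from [hs ++ hs]. By polarization the two sesquilinear forms agree, so [form_positivity]
    applies. *)
Lemma form_Re_positivity s (hs : seq (seq ({ffun 'I_k -> int} * H))) :
  (forall p, p \in s -> (Zplus `|` Zminus) p.1) ->
  (forall lam x, torus lam ->
     complex.Re (form_eval s lam x x) =
     complex.Re (\sum_(h <- hs) `|vec_eval h lam x| ^+ 2)) ->
  0 <= complex.Re (\sum_(p <- s) inner (bracket_power A p.1 p.2.1) p.2.2).
Proof.
move=> sD sE; pose s' := [seq (- p.1, (p.2.2, p.2.1)) | p <- s].
have s'E lam x y : torus lam -> form_eval s' lam x y = (form_eval s lam y x)^*.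
  move=> lamT; rewrite /form_eval big_map rmorph_sum; apply: eq_bigr => p _ /=.
  by rewrite !rmorphM /= monomial_conj // -!innerC mulrAC.
have nonneg lam x : \sum_(h <- hs) `|vec_eval h lam x| ^+ 2 \is Num.real.
  by apply: ger0_real; apply: sumr_ge0 => h _; rewrite exprn_ge0.
have s'D p : p \in s ++ s' -> (Zplus `|` Zminus) p.1.
  rewrite mem_cat => /orP[/sD//|/mapP[p' /sD[p'D|p'D] ->]]; [right|left] => l.
    by rewrite ffunE oppr_le0.
  by rewrite ffunE oppr_ge0.
have := form_positivity (s := s ++ s') (hs := hs ++ hs) s'D; rewrite big_cat /=.
rewrite (_ : \sum_(p <- s') _ =
    (\sum_(p <- s) inner (bracket_power A p.1 p.2.1) p.2.2)^*); last first.
  rewrite big_map rmorph_sum; apply: eq_big_seq => p /sD [pD|pD] /=.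
    by rewrite [in RHS](bracket_power_conj _ _ pD) conjCK.
  have mD : Zplus (- p.1) by move=> l; rewrite ffunE oppr_ge0.
  by rewrite (bracket_power_conj _ _ mD) opprK.
move=> h.
have : 0 <= 2 * (complex.Re (\sum_(p <- s) inner (bracket_power A p.1 p.2.1) p.2.2))%:C%C.
  rewrite -addcJ; apply: h => lam x y lamT; apply/eqP; rewrite -subr_eq0; apply/eqP.
  pose D x y := form_eval (s ++ s') lam x y -
    \sum_(h <- hs ++ hs) vec_eval h lam x * (vec_eval h lam y)^*.
  rewrite -/(D x y); apply: sesquilinear_eq0 => {x y} [a x x' y|a x y y'|x].
  - rewrite /D form_evalPl mulrBr addrACA -opprD; congr (_ - _).
    rewrite mulr_sumr -big_split; apply: eq_bigr => h' _ /=.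
    by rewrite vec_evalP; ring.
  - rewrite /D form_evalPr mulrBr addrACA -opprD; congr (_ - _).
    rewrite mulr_sumr -big_split; apply: eq_bigr => h' _ /=.
    by rewrite vec_evalP rmorphD rmorphM /= conjCK; ring.
  - rewrite /D /form_eval !big_cat /= -!/(form_eval _ _ _ _) s'E // addcJ sE //.
    rewrite (_ : \sum_(h <- hs) _ * _ = \sum_(h <- hs) `|vec_eval h lam x| ^+ 2).
      by rewrite RRe_real // -mulr2n mulr_natl subrr.
    by apply: eq_bigr => h' _; rewrite normCK.
by rewrite pmulr_rge0 ?ltr0n // ler0c.
Qed.

(** The data of the extension theorem: [W] allows all frequencies, [C] is the cone of sums of
    squares, [g] is the graph prescribed by [A] on [Zplus] and [Zminus]. Real parts are taken
    because that theorem is over [R]. *)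
Let W : set (@torus_vectors R H k -> R) := [set v | exists s, v = @complex.Re R \o form_fun s].

Let C : set (@torus_vectors R H k -> R) :=
  [set v | exists hs : seq (seq ({ffun 'I_k -> int} * H)),
    v = fun w => complex.Re (\sum_(h <- hs) `|vec_fun h w| ^+ 2)].

Let g : set ((@torus_vectors R H k -> R) * R) := [set p | exists s, [/\
  forall q, q \in s -> (Zplus `|` Zminus) q.1, p.1 = @complex.Re R \o form_fun s &
  p.2 = complex.Re (\sum_(q <- s) inner (bracket_power A q.1 q.2.1) q.2.2)]].

Lemma Re_complexZ (a : R) (z : R[i]) : complex.Re (a%:C%C * z) = a * complex.Re z.
Proof. by case: z => x y; rewrite /= mul0r subr0. Qed.

Let W_comb a v v' : W v -> W v' -> W (a *: v + v').
Proof.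
move=> [s ->] [s' ->]; exists (scale_terms a%:C%C s ++ s'); apply/funext => w.
by rewrite form_funD form_funZ /= raddfD /= Re_complexZ.
Qed.

Let g_comb : linear_graph g.
Proof.
move=> a [v r] [v' r'] /= [s [sD /= -> ->]] [s' [s'D /= -> ->]].
exists (scale_terms a%:C%C s ++ s'); split=> [p| |].
- by rewrite mem_cat => /orP[/mapP[q /sD qD ->]|/s'D].
- apply/funext => w; by rewrite form_funD form_funZ /= raddfD /= Re_complexZ.
rewrite big_cat big_map raddfD -Re_complexZ mulr_sumr /=; congr (complex.Re _ + _).
by apply: eq_big_seq => p /sD pD; rewrite /= bracket_powerZ.
Qed.

Let g_pos : positive_graph C g.
Proof.
move=> [v r] /= [s [sD /= -> ->]] [hs hsE].
apply: (form_Re_positivity (hs := hs)) => // lam x lamT.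
by have := congr1 (fun F => F (exist _ lam lamT, x)) hsE.
Qed.

Let C_add v v' : C v -> C v' -> C (v + v').
Proof.
move=> [hs ->] [hs' ->]; exists (hs ++ hs'); apply/funext => w.
by rewrite big_cat raddfD.
Qed.

Let C_scale a v : 0 <= a -> C v -> C (a *: v).
Proof.
move=> a0 [hs ->]; exists [seq [seq (b.1, (Num.sqrt a)%:C%C *: b.2) | b <- h] | h <- hs].
apply/funext => w; rewrite big_map scalrfctE -[LHS]Re_complexZ mulr_sumr; congr complex.Re.
apply: eq_bigr => h _; rewrite -[a in LHS]sqr_sqrtr // rmorphXn /=.
rewrite -[X in X ^+ 2 * _]ger0_norm ?ler0c ?sqrtr_ge0 //.
rewrite -exprMn -normrM; congr (`|_| ^+ 2).
rewrite /vec_fun /vec_eval big_map mulr_sumr; apply: eq_bigr => b _ /=.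
by rewrite innerZl mulrCA.
Qed.

Let C_0 : C 0.
Proof. by exists [::]; apply/funext => w; rewrite big_nil. Qed.

(* By [2 Re (u v^* ) = |u|^2 + |v|^2 - |u - v|^2], every frequency is bounded
   by the constant ones. *)
Let g_cofinal v : W v -> exists2 p, g p & C (p.1 - v).
Proof.
move=> [s ->].
have zD : (@Zplus k `|` Zminus) 0 by left=> l; rewrite ffunE.
pose z := [seq (0, (2^-1 *: p.2.1, p.2.1)) | p <- s] ++
    [seq (0, (2^-1 *: p.2.2, p.2.2)) | p <- s]
  : seq ({ffun 'I_k -> int} * (H * H)).
exists (@complex.Re R \o form_fun z,
        complex.Re (\sum_(q <- z) inner (bracket_power A q.1 q.2.1) q.2.2)).
  exists z; split=> // q; rewrite /z.
  by rewrite mem_cat => /orP[] /mapP[p _ ->].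
(* A term lam^p <f, x> <x, g> is paired with the square of lam^p f - g; half of that square is the
   constant part in [z] minus the real part of the term. *)
pose hs := [seq [:: (p.1, p.2.1); (0, - p.2.2)] | p <- s] : seq (seq ({ffun 'I_k -> int} * H)).
suff : (@complex.Re R \o form_fun z) - (@complex.Re R \o form_fun s) =
    2^-1 *: (fun w => complex.Re (\sum_(h <- hs) `|vec_fun h w| ^+ 2)).
  by move=> ->; apply: C_scale; [rewrite invr_ge0 ler0n|exists hs].
apply/funext => w; have wT := torus_vectorsP w.
transitivity (complex.Re (form_fun z w - form_fun s w)); first by rewrite raddfB.
rewrite scalrfctE -[RHS]Re_complexZ.
have ReJ (u : R[i]) : complex.Re u = complex.Re ((2^-1)%:C%C * (u + u^*)).
  rewrite addcJ mulrA -(rmorph_nat (real_complex R)) -rmorphM mulVf ?pnatr_eq0 //.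
  by rewrite mul1r.
rewrite raddfB /= [complex.Re (form_fun s w)]ReJ -raddfB; congr complex.Re.
have zE : form_fun z w = \sum_(p <- s)
    2^-1 * (inner p.2.1 w.2 * inner w.2 p.2.1 + inner p.2.2 w.2 * inner w.2 p.2.2).
  rewrite /form_fun /form_eval big_cat /= !big_map -big_split; apply: eq_bigr => p _ /=.
  by rewrite !monomial0 !innerZl; ring.
have sE : form_fun s w + (form_fun s w)^* = \sum_(p <- s)
    (monomial (sval w.1) p.1 * inner p.2.1 w.2 * inner w.2 p.2.2 +
     monomial (sval w.1) (- p.1) * inner w.2 p.2.1 * inner p.2.2 w.2).
  rewrite /form_fun /form_eval rmorph_sum -big_split; apply: eq_bigr => p _ /=.
  by rewrite !rmorphM /= -!innerC monomial_conj.
rewrite zE sE big_map !mulr_sumr -sumrB; apply: eq_bigr => p _.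
rewrite normCK /vec_fun /vec_eval !big_cons !big_nil /=.
rewrite monomial0 addr0 mul1r -[- p.2.2]scaleN1r innerZl rmorphD !rmorphM rmorphN1 /= -!innerC.
rewrite monomial_conj // fmorphV rmorph_nat.
have := monomialK p.1 wT; set M := monomial _ (- p.1); set N := monomial _ p.1 => MN.
transitivity (2^-1 * ((M * N) * (inner p.2.1 w.2 * inner w.2 p.2.1) +
    inner p.2.2 w.2 * inner w.2 p.2.2) -
  2^-1 * (N * inner p.2.1 w.2 * inner w.2 p.2.2 + M * inner w.2 p.2.1 * inner p.2.2 w.2)).
  by rewrite MN mul1r.
by ring.
Qed.

Let exists_functional : exists l : (@torus_vectors R H k -> R) -> R,
  [/\ forall p, g p -> l p.1 = p.2,
      forall (a : R) x y, W x -> W y -> l (a *: x + y) = a * l x + l y &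
      forall x, W x -> C x -> 0 <= l x].
Proof.
apply: riesz_extension => //.
- move=> v Wv; have := W_comb (-2) Wv Wv.
  by rewrite -[X in _ + X]scale1r -scalerDl (_ : -2 + 1 = -1) ?scaleN1r //; ring.
- exists [::]; split=> //=; last by rewrite big_nil.
  by apply/funext => w; rewrite /form_fun /form_eval /= big_nil.
Qed.

(** * The dilation defined by the extended functional *)

Section FunctionalDilation.
Implicit Types (s : seq ({ffun 'I_k -> int} * (H * H))).
Variable l : (@torus_vectors R H k -> R) -> R.
Hypothesis lg : forall p, g p -> l p.1 = p.2.
Hypothesis lP : forall (a : R) v v', W v -> W v' -> l (a *: v + v') = a * l v + l v'.
Hypothesis lpos : forall v, W v -> C v -> 0 <= l v.

Let L (F : @torus_vectors R H k -> R[i]) : R[i] :=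
  Complex (l (@complex.Re R \o F)) (l (@complex.Im R \o F)).

Let W_Re s : W (@complex.Re R \o form_fun s).
Proof. by exists s. Qed.

(** This puts imaginary parts into [W] and makes the prescribed values of [l] available for them. *)
Let Im_form s : @complex.Im R \o form_fun s = @complex.Re R \o form_fun (scale_terms (- 'i) s).
Proof.
apply/funext => w; rewrite form_funZ scalrfctE /=; case: (form_fun s w) => x y.
by rewrite -complexiE /GRing.scale /=; ring.
Qed.

Let W_Im s : W (@complex.Im R \o form_fun s).
Proof. by rewrite Im_form. Qed.

Let W_0 : W 0.
Proof.
exists [::]; apply/funext => w.
by rewrite /form_fun /form_eval /= big_nil.
Qed.

Let l0 : l 0 = 0.
Proof.
have := lP 1 W_0 W_0; rewrite scale1r mul1r addr0 => /eqP.
by rewrite -subr_eq0 opprD addrA subrr sub0r oppr_eq0 => /eqP.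
Qed.

Let lN v : W v -> l (- v) = - l v.
Proof. by move=> Wv; have := lP (-1) Wv W_0; rewrite l0 !addr0 scaleN1r mulN1r. Qed.

Let LP a s s' : L (a *: form_fun s + form_fun s') = a * L (form_fun s) + L (form_fun s').
Proof.
case: a => x y; rewrite /L.
have -> : @complex.Re R \o (Complex x y *: form_fun s + form_fun s') =
    x *: (@complex.Re R \o form_fun s) +
    ((- y) *: (@complex.Im R \o form_fun s) + (@complex.Re R \o form_fun s')).
  apply/funext => w; rewrite !fctE.
  case: (form_fun s w) => b c; case: (form_fun s' w) => b' c' /=.
  by rewrite /GRing.scale /=; ring.
have -> : @complex.Im R \o (Complex x y *: form_fun s + form_fun s') =
    x *: (@complex.Im R \o form_fun s) +
    (y *: (@complex.Re R \o form_fun s) + (@complex.Im R \o form_fun s')).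
  apply/funext => w; rewrite !fctE.
  case: (form_fun s w) => b c; case: (form_fun s' w) => b' c' /=.
  by rewrite /GRing.scale /=; ring.
rewrite !lP //; try exact: W_comb.
by apply/eqP; rewrite eq_complex /=; apply/andP; split; apply/eqP; ring.
Qed.

Let L_conj s : L (fun w => (form_fun s w)^*) = (L (form_fun s))^*.
Proof.
rewrite /L.
have -> : @complex.Re R \o (fun w => (form_fun s w)^*) = @complex.Re R \o form_fun s.
  by apply/funext => w /=; case: (form_fun s w).
have -> : @complex.Im R \o (fun w => (form_fun s w)^*) = - (@complex.Im R \o form_fun s).
  by apply/funext => w; rewrite opprfctE /=; case: (form_fun s w).
by rewrite lN.
Qed.

Let L_form s : (forall p, p \in s -> (Zplus `|` Zminus) p.1) ->
  L (form_fun s) = \sum_(p <- s) inner (bracket_power A p.1 p.2.1) p.2.2.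
Proof.
move=> sD; have key s' : (forall p, p \in s' -> (Zplus `|` Zminus) p.1) ->
    l (@complex.Re R \o form_fun s') =
    complex.Re (\sum_(p <- s') inner (bracket_power A p.1 p.2.1) p.2.2).
  by move=> s'D; apply: (lg (p := (_, _))); exists s'.
have isD p : p \in scale_terms (- 'i) s -> (Zplus `|` Zminus) p.1.
  by move=> /mapP[q /sD qD ->].
rewrite /L key // Im_form key //.
have -> : \sum_(p <- scale_terms (- 'i) s) inner (bracket_power A p.1 p.2.1) p.2.2 =
    - 'i * \sum_(p <- s) inner (bracket_power A p.1 p.2.1) p.2.2.
  rewrite big_map mulr_sumr; apply: eq_big_seq => p /sD pD.
  by rewrite /= bracket_powerZ.
case: (\sum_(p <- s) _) => x y.
by rewrite -complexiE /=; congr Complex; ring.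
Qed.

(* [L] is the complexification of [l], so that the scalar product of two
   polynomials is the functional applied to the scalar function [h h'^*]. *)
Let form (h h' : @vec_trig R H k) : R[i] := L (fun w => h w * (h' w)^*).

Let formP h' : scalar (form^~ h').
Proof.
move=> a h1 h2; rewrite /form.
have [t tE] := vec_trigP h'; have [t1 t1E] := vec_trigP h1; have [t2 t2E] := vec_trigP h2.
rewrite tE t1E t2E !vec_fun_mul_conj -LP -!vec_fun_mul_conj; congr L.
apply/funext => w; rewrite -t1E -t2E !fctE /=.
by rewrite [LHS](_ : _ = (a * h1 w + h2 w) * (vec_fun t w)^*) // mulrDl -mulrA.
Qed.

Let formC h h' : form h h' = (form h' h)^*.
Proof.
have [t tE] := vec_trigP h; have [t' t'E] := vec_trigP h'.
rewrite /form tE t'E [in RHS]vec_fun_mul_conj -L_conj -vec_fun_mul_conj; congr L.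
by apply/funext => w; rewrite rmorphM /= conjCK mulrC.
Qed.

Let form_ge0 h : 0 <= form h h.
Proof.
have [t tE] := vec_trigP h; rewrite /form tE.
have ImE : @complex.Im R \o (fun w => vec_fun t w * (vec_fun t w)^*) = 0.
  by apply/funext => w /=; rewrite ger0_Im // mul_conjC_ge0.
rewrite /L ImE l0 lecE /= eqxx /=; apply: lpos; first by rewrite vec_fun_mul_conj.
by exists [:: t]; apply/funext => w; rewrite /= big_seq1 normCK.
Qed.

Let sp := SemiInner formP formC form_ge0.

Let delta (i : 'I_k) : {ffun 'I_k -> int} := [ffun j => ((j == i) : nat)%:Z].

Let monomial_delta lam i : monomial lam (delta i) = lam i :> R[i].
Proof.
rewrite /monomial (bigD1 i) //= big1 => [|j ji]; first by rewrite ffunE eqxx expr1z mulr1.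
by rewrite ffunE (negPf ji) expr0z.
Qed.

Let V i : {linear @vec_trig R H k -> @vec_trig R H k} := mul_monomial (delta i).
Let V' i : {linear @vec_trig R H k -> @vec_trig R H k} := mul_monomial (- delta i).

Let VK i : cancel (V i) (V' i).
Proof. by move=> h; apply: etrans (esym (mul_monomialD _ _ _)) _; rewrite addNr mul_monomial0. Qed.

Let V'K i : cancel (V' i) (V i).
Proof. by move=> h; apply: etrans (esym (mul_monomialD _ _ _)) _; rewrite addrN mul_monomial0. Qed.

Let V_iso i h h' : sp (V i h) (V i h') = sp h h'.
Proof.
rewrite /= /form; congr L; apply/funext => w /=; have wT := torus_vectorsP w.
rewrite rmorphM /= monomial_conj // mulrACA [monomial _ _ * _]mulrC.
by rewrite monomialK // mul1r.
Qed.

Let U i : {linear completion sp -> completion sp} := completion_lift (@V'K i) (@V_iso i).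

Let U_comm : commuting U.
Proof.
move=> i j F /=; apply: completion_ext => h /=.
congr (F _); apply: etrans (esym (mul_monomialD _ _ _)) _.
by rewrite addrC mul_monomialD.
Qed.

Let U_power b h : multi_power (fun i => U i) b (completion_embed sp h) =
  completion_embed sp (multi_power (fun i => V i) b h).
Proof.
rewrite /multi_power; elim/big_rec2: _ => //= i f f' _ ->.
by elim: (b i) => //= n ->; exact: completion_lift_embed.
Qed.

Let V_power b h w : multi_power (fun i => V i) b h w = (\prod_(i < k) sval w.1 i ^+ b i) * h w.
Proof.
rewrite /multi_power; elim/big_rec2: _ => /= [|i f p _ IH]; first by rewrite mul1r.
rewrite -mulrA -IH; elim: (b i) => /= [|n ->]; first by rewrite mul1r.
by rewrite monomial_delta exprS mulrA.
Qed.

Let J : {linear H -> completion sp} := completion_embed sp \o @const_trig R H k.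

(** The dilation identity in weak form: the left side is [L] at lam^al <f, x> <x, g'>, a form with
    its frequency in [Zplus], where [L] has its prescribed value. *)
Let J_inner al f g' : Zplus al ->
  inner (bracket_power U al (J f)) (J g') = inner (bracket_power A al f) g'.
Proof.
move=> alp; have alD : (Zplus `|` Zminus) al by left.
rewrite [in LHS]/bracket_power asboolT // -[abs_power _ al]/(multi_power _ _) U_power.
rewrite [LHS]completion_inner_embed /= /form.
transitivity (L (form_fun [:: (al, (f, g'))])); last first.
  by rewrite L_form ?big_seq1 // => p; rewrite inE => /eqP ->.
congr L; apply/funext => w; rewrite V_power /= -innerC /form_fun /form_eval big_seq1 /=.
congr (_ * _ * _); apply: eq_bigr => i _; have := alp i.
by case: (al i) => // n _; rewrite exprnP.
Qed.

Lemma functional_dilation : has_unitary_power_dilation A.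
Proof.
(* This is [J_inner] at al = 0. *)
have J_iso x : `|J x| = `|x|.
  apply/eqP; rewrite -(@eqrXn2 _ 2) // -!innerE; apply/eqP.
  have := @J_inner 0 x x; rewrite !bracket_power0; apply.
  by move=> i; rewrite ffunE.
have /choice[P PJ] := isometry_projection J_iso.
exists (completion sp), J, U, (J \o P); split=> //.
- by move=> i; exact: completion_lift_unitary.
- by move=> y; split=> [|_ [z _ <-]]; [exists (P y)|exact: PJ].
move=> al alp x; apply: (congr1 J); apply: inner_eq => z.
rewrite -J_inner // -[RHS](isometry_inner J_iso); apply/eqP.
by rewrite -subr_eq0 -innerBl PJ.
Qed.

End FunctionalDilation.

Lemma complete_positivity_dilation : has_unitary_power_dilation A.
Proof.
by have [l [lg lP lpos]] := exists_functional; exact: (functional_dilation lg lP lpos).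
Qed.

End CompletePositivity.

(** * The equivalence of the three conditions *)

Theorem theorem32 (R : realType) (k : nat) (k_gt0 : (0 < k)%N)
    (H : hilbertType R) (A : 'I_k -> {linear H -> H})
    (bA : forall i, bounded_op (A i))
    (Y : set ('I_k -> R[i])) (detY : determining Y) :
  [<-> (* (i) *)
       has_unitary_power_dilation A /\ commuting A;
       (* (ii) *)
       forall (m : nat) (a : 'I_m -> 'I_m -> {ffun 'I_k -> int} -> R[i]),
         (0 < m)%N -> (forall i j, finite_system (a i j)) ->
         (forall (lam : 'I_k -> R[i]) (z : 'I_m -> R[i]), torus lam ->
            0 <= \sum_(i < m) \sum_(j < m) \sum_(al \in Zplus `|` Zminus)
                   (a i j al * monomial lam al * z i * (z j)^*)) ->
         forall f : 'I_m -> H,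
           0 <= \sum_(i < m) \sum_(j < m) \sum_(al \in Zplus `|` Zminus)
                  (a i j al * inner (bracket_power A al (f i)) (f j));
       (* (iii) *)
       forall (m : nat) (a : 'I_m -> 'I_m -> {ffun 'I_k -> int} -> R[i]),
         (0 < m)%N -> (forall i j, finite_system (a i j)) ->
         (exists (n : nat) (q : 'I_m -> 'I_n -> ('I_k -> R[i]) -> R[i]),
            [/\ (0 < n)%N,
                forall i l, analytic_trig_poly (q i l) &
                forall lam, Y lam -> forall i j,
                  \sum_(al \in Zplus `|` Zminus) (a i j al * monomial lam al) =
                  \sum_(l < n) q i l lam * (q j l lam)^*]) ->
         forall f : 'I_m -> H,
           0 <= \sum_(i < m) \sum_(j < m) \sum_(al \in Zplus `|` Zminus)
                  (a i j al * inner (bracket_power A al (f i)) (f j))].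
Proof.
have [_ YT _] := detY.
tfae.
- move=> [[K [J [U [P [Jiso Uunit UC PJ dil]]]]] AC] m a _ afin apos.
  exact: (dilation_positivity Jiso Uunit UC PJ dil AC afin apos).
- move=> Apos m a m0 afin [n [q [_ qan Yeq]]].
  exact: (Apos m a m0 afin (determining_positivity detY afin qan Yeq)).
- move=> Apos; split; first exact: complete_positivity_dilation YT Apos.
  exact: complete_positivity_commuting YT Apos.
Qed.
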